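(* For every $n\ge1$ and every non-crossing partition $P$ of $[n]$, we have $$P=P_\circ(\mathcal{T}^\circ(P))=P_\bullet(\mathcal{T}^\bullet(P)).$$
   Context: Non-crossing partitions. A partition of $[n]=\{1,\dots,n\}$ is non-crossing if, when $1,\dots,n$ are placed in clockwise order at the vertices of a regular $n$-gon, the convex hulls of its blocks are pairwise disjoint. Plane trees. Plane trees are finite rooted trees with ordered children (as finite subsets of $\bigcup_{m\ge0}\mathbb{N}^m$, with root $\varnothing$, children of $u$ denoted $u1,\dots,uk_u$, where $k_u$ is the outdegree; $pr(u)$ is the parent of $u$). Vertices are ordered lexicographically (depth-first order). Dual tree. Draw $P$ with $l\in[n]$ at $e^{-2\mathrm{i}\pi l/n}$ and each block as its polygon (singletons being viewed as self-loops and blocks of size two as double edges). Put a black vertex inside each block and a white vertex inside each other face of the disk, and join two vertices if the corresponding faces share a common edge (equivalently: for each $l\in[n]$ there is one edge joining the block containing $l$ to the white face whose boundary contains the arc of circle going clockwise from $l$ to $l+1$, where $n+1$ means $1$). This gives a planar (unrooted) bipartite tree $T(P)$ with $n+1$ vertices. $T^\circ(P)$ is the plane tree obtained by rooting $T(P)$ at the white vertex of the face containing the vertices $1$ and $n$ (the face adjacent to the arc from $n$ to $1$), so that its first child is the block containing $1$. $T^\bullet(P)$ is obtained by rooting $T(P)$ at the black vertex of the block containing $n$, so that its first child is the white vertex of the face containing the vertices $1$ and $n$. In both cases, children are listed in clockwise order (starting from the root corner for the root, from the edge to the parent for other vertices). Janson–Stefánsson bijection $\mathcal{G}$. For a plane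 tree $T$, $\mathcal{G}(T)$ is a plane tree on the same vertices. If $T=\{\varnothing\}$, $\mathcal{G}(T)=\{\varnothing\}$. Otherwise, for every vertex $u$ at even generation of $T$ with $k_u\ge1$ children: if $u\ne\varnothing$, draw an edge between $pr(u)$ and $u1$; draw edges between consecutive children $u1$–$u2$, …, $u(k_u-1)$–$uk_u$; draw an edge between $uk_u$ and $u$. If $u$ is a leaf at even generation, draw an edge between $u$ and $pr(u)$. The root of $\mathcal{G}(T)$ is the first child of the root of $T$. Explicitly: vertices at even generation of $T$ become leaves, and a vertex $v$ at odd generation with $k$ children $v1,\dots,vk$ has $k+1$ ordered children in $\mathcal{G}(T)$: $c(v1),\dots,c(vk)$, followed by the next sibling of $v$ in $T$ if there is one and by $pr(v)$ otherwise, where $c(vi)$ is the first child of $vi$ in $T$ if $vi$ has children and $c(vi)=vi$ otherwise. Set $\mathcal{T}^\circ(P)=\mathcal{G}(T^\circ(P))$ and $\mathcal{T}^\bullet(P)=\mathcal{G}(T^\bullet(P))$. From trees to partitions. A twig of a tree is a path $\llbracket u,v\rrbracket$ where $u$ is an ancestor of $v$ and every vertex of the path other than $u$ is the last child of its parent ($\llbracket u,u\rrbracket$ is a twig for every $u$). For a plane tree $\tau$ with $n+1$ vertices $\varnothing=u(0)\prec u(1)\prec\dots\prec u(n)$ in lexicographical order, $P_\circ(\tau)$ and $P_\bullet(\tau)$ are the (non-crossing) partitions of $[n]$ such that: $i,j$ are in the same block of $P_\circ(\tau)$ iff $u(i)$ and $u(j)$ have the same parent in $\tau$; $i,j$ are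 in the same block of $P_\bullet(\tau)$ iff $u(i)$ and $u(j)$ belong to a same twig of $\tau$. *)

(* Defs.v *)
From HB Require Import structures.
From mathcomp Require Import all_boot all_order all_algebra.
From mathcomp Require Import all_classical all_reals all_analysis.

Set Implicit Arguments.
Unset Strict Implicit.
Unset Printing Implicit Defensive.

Import Order.TTheory GRing.Theory Num.Theory.
Import numFieldNormedType.Exports.

Local Open Scope ring_scope.

(** * Non-crossing partitions

   The element [l] of {1, ..., n} is represented by [i : 'I_n] with
   [l = i.+1]. A set of subsets of {1, ..., n} is a [{set {set 'I_n}}]. *)

Section Geometry.
Local Open Scope classical_set_scope.
Variables (R : realType) (n : nat).

(* The point exp(-2 i pi x / n) of the unit circle; the sign makes the
   integer points x = 1, ..., n appear in clockwise order. *)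
Definition circle_pt (x : R) : R * R :=
  (cos (2 * pi * x / n%:R), - sin (2 * pi * x / n%:R)).

Definition vertex_pt (i : 'I_n) : R * R := circle_pt i.+1%:R.

(* The midpoint of the arc of circle going clockwise from l to l + 1 (from n
   to 1 if l = n), where l = i.+1. *)
Definition arc_mid (i : 'I_n) : R * R := circle_pt (i.+1%:R + 2^-1).

Definition hull (B : {set 'I_n}) : set (R * R) :=
  [set p | exists w : 'I_n -> R,
     [/\ forall i, 0 <= w i,
         \sum_(i in B) w i = 1,
         p.1 = \sum_(i in B) w i * (vertex_pt i).1
       & p.2 = \sum_(i in B) w i * (vertex_pt i).2]].

Definition noncrossing (P : {set {set 'I_n}}) : Prop :=
  forall A B : {set 'I_n}, A \in P -> B \in P -> A != B ->
    hull A `&` hull B = set0.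

Definition disk : set (R * R) := [set p | p.1 ^+ 2 + p.2 ^+ 2 <= 1].

(* The white faces are the connected components of the disk deprived of the
   polygons. [white_face P i] is the one that has the arc from l = i.+1 to
   l + 1 on its boundary: this open arc avoids all polygons and is connected,
   so it lies in the component of its midpoint. Fattening the blocks of size
   one and two into loops and double edges does not change the arcs that
   share a component. *)
Definition white_face (P : {set {set 'I_n}}) (i : 'I_n) : set (R * R) :=
  connected_component (disk `\` \bigcup_(B in [set` P]) hull B) (arc_mid i).

End Geometry.

(** * Plane trees *)

Inductive ptree : Type := PNode of seq ptree.

Definition branches (t : ptree) : seq ptree := let: PNode ts := t in ts.

(* Vertices are Ulam-Harris words, with children numbered from 0: the root is
   [[::]] and the (i+1)-st child of u is [rcons u i]. *)
Definition vertex := seq nat.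

(* All the vertices, in depth-first (lexicographical) order. *)
Fixpoint vertices (t : ptree) : seq vertex :=
  let: PNode ts := t in
  [::] :: flatten
    [seq [seq p.1 :: u | u <- p.2] |
       p <- zip (iota 0 (size ts)) (map vertices ts)].

Fixpoint subtree (t : ptree) (u : vertex) : ptree :=
  if u is i :: u' then subtree (nth (PNode [::]) (branches t) i) u' else t.

Definition outdeg (t : ptree) (u : vertex) : nat :=
  size (branches (subtree t u)).

Definition parent (u : vertex) : vertex := take (size u).-1 u.

(* The plane tree with root x obtained from an ordered list of children for
   each node, cut at height h. It is always used with h at least the height
   of the untruncated tree, so that nothing is lost. *)
Fixpoint grow (V : Type) (children : V -> seq V) (h : nat) (x : V) : ptree :=
  if h is h'.+1 then PNode (map (grow children h') (children x))
  else PNode [::].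

(** * The dual tree

   The tree T(P) has one edge for each l in {1, ..., n}, joining the block
   containing l to the white face bordered by the arc from l to l + 1. Edges
   are therefore indexed by 'I_n. *)

Inductive colour := White | Black.

Definition opp_colour (c : colour) : colour :=
  if c is White then Black else White.

Section DualTree.
Variables (R : realType) (n : nat) (P : {set {set 'I_n}}).

(* The edges that have the same endpoint of colour c as the edge i. *)
Definition star (c : colour) (i : 'I_n) : {set 'I_n} :=
  match c with
  | Black => finset.pblock P i
  | White => [set j | `[< white_face P j = white_face P i :> set (R * R) >]]
  end.

(* The edges around the endpoint of colour c of the edge i, in clockwise
   order and starting with i. The clockwise order around a block is that of
   the elements of the block, and the one around a white face is that of the
   arcs on its boundary: in both cases it is the cyclic order of the labels.
   (The enumeration of a {set 'I_n} is increasing.) *)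
Definition clockwise (c : colour) (i : 'I_n) : seq 'I_n :=
  rot (index i (enum (star c i))) (enum (star c i)).

(* The node (c, i) stands for the endpoint of colour c of the edge i, when
   i is the edge that joins it to its parent. *)
Definition dual_children (x : colour * 'I_n) : seq (colour * 'I_n) :=
  [seq (opp_colour x.1, j) | j <- behead (clockwise x.1 x.2)].

(* T(P) has n edges, so that a branch above the root has height less than n. *)
Definition dual_branch (c : colour) (i : 'I_n) : ptree :=
  grow dual_children n (c, i).

Lemma last_label_subproof (hn : (0 < n)%N) : (n.-1 < n)%N.
Proof. by rewrite ltn_predL. Qed.

(* The label n. *)
Definition last_label (hn : (0 < n)%N) : 'I_n :=
  Ordinal (last_label_subproof hn).

(* Around the white root, the arc from n to 1 is the one just before the root
   corner, so the edge n comes last; the first child is the block of 1. *)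
Definition dual_white (hn : (0 < n)%N) : ptree :=
  PNode [seq dual_branch Black j | j <- rot 1 (clockwise White (last_label hn))].

Definition dual_black (hn : (0 < n)%N) : ptree :=
  PNode [seq dual_branch White j | j <- clockwise Black (last_label hn)].

End DualTree.

(** * The Janson-Stefansson bijection *)

(* The vertex written c(u): the first child of u if u has children, else u. *)
Definition first_child_or_self (t : ptree) (u : vertex) : vertex :=
  if outdeg t u is 0%N then u else rcons u 0%N.

Definition next_sibling (u : vertex) : vertex :=
  rcons (parent u) (last 0%N u).+1.

(* The ordered children in G(t) of a vertex v of t. *)
Definition js_children (t : ptree) (v : vertex) : seq vertex :=
  if odd (size v) then
    rcons [seq first_child_or_self t (rcons v i) | i <- iota 0 (outdeg t v)]
      (if ((last 0%N v).+1 < outdeg t (parent v))%N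
       then next_sibling v else parent v)
  else [::].

Definition janson_stefansson (t : ptree) : ptree :=
  if t is PNode [::] then PNode [::]
  else grow (js_children t) (size (vertices t)) [:: 0%N].

(** * From trees to partitions

   Both partitions are meant for a tree t with n + 1 vertices. *)

Section TreeToPartition.
Variables (n : nat) (t : ptree).

(* The vertex u(l), where l = i.+1 and u(0) is the root. *)
Definition nth_vertex (i : 'I_n) : vertex := nth [::] (vertices t) i.+1.

Definition same_parent (i j : 'I_n) : bool :=
  parent (nth_vertex i) == parent (nth_vertex j).

Definition partition_white : {set {set 'I_n}} :=
  equivalence_partition same_parent [set: 'I_n].

Definition is_last_child (w : vertex) : bool :=
  w == rcons (parent w) (outdeg t (parent w)).-1.

(* w lies on the path from u to its descendant v *)
Definition on_path (u v w : vertex) : bool := prefix u w && prefix w v.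

Definition is_twig (u v : vertex) : bool :=
  prefix u v &&
  all (fun w => (on_path u v w && (w != u)) ==> is_last_child w) (vertices t).

Definition same_twig (i j : 'I_n) : bool :=
  has (fun u => has (fun v =>
    [&& is_twig u v, on_path u v (nth_vertex i) & on_path u v (nth_vertex j)])
    (vertices t)) (vertices t).

Definition partition_black : {set {set 'I_n}} :=
  equivalence_partition same_twig [set: 'I_n].

End TreeToPartition.

(* Main.v *)
Require Import Defs.
From HB Require Import structures.
From mathcomp Require Import all_boot all_order all_algebra.
From mathcomp Require Import all_classical all_reals all_analysis.
From mathcomp Require Import zify ring lra.

(** The chord joining two arcs of the circle avoids every polygon when no block
   has vertices on both sides of it, and otherwise some block contains a chord
   separating them. So the white faces are the classes of the Kreweras
   complement: l and m > l share a face iff {l+1, ..., m} is a union of blocks.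

   Give the arc from n to 1 the second label 0, which is a block of its own for
   the white root and belongs to the block of n for the black root. Then, in
   T(P), the edge from a block to its parent carries the largest element of the
   block and the edge from a white vertex to its parent carries the smallest
   label of the face. If q < q' are consecutive labels of a face, then q + 1 is
   the smallest element of the block of q'. Consequently the image of T(P) by
   the bijection is the tree on {0, ..., n} in which the parent of m is
   - min(block of m) - 1, for the white root,
   - the least a such that {a+1, ..., m-1} is a union of blocks, for the black
     root.
   In both cases m1 < m2 and par m2 < m1 imply par m2 <= par m1, so that the
   depth-first order is 0, 1, ..., n. The first description shows that siblings
   are the elements of a block; in the second one, m is the last child of its
   parent iff they are in the same block. *)

Set Implicit Arguments.
Unset Strict Implicit.
Unset Printing Implicit Defensive.

(** * Trees grown from a list of children *)

Definition colour_bool (c : colour) : bool := if c is White then true else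
  false.
Definition bool_colour (b : bool) : colour := if b then White else Black.
Lemma colour_boolK : cancel colour_bool bool_colour.
Proof. by case. Qed.
HB.instance Definition _ := Equality.copy colour (can_type colour_boolK).

Section Grow.
Variables (V : eqType) (ch : V -> seq V).

(** Words are interpreted directly in the unfolding of [ch] from [x], without building the tree:
    [walk] gives the node reached, and [valid] tells whether the word exists there. *)
Fixpoint walk x u := if u is i :: u' then walk (nth x (ch x) i) u' else x.

Fixpoint valid x u :=
  if u is i :: u' then (i < size (ch x)) && valid (nth x (ch x) i) u' else true.

Fixpoint preorder h x :=
  x :: (if h is h'.+1 then flatten (map (preorder h') (ch x)) else [::]).

(** Truncation at height [h] loses nothing. *)
Fixpoint fits h x :=
  if h is h'.+1 then all (fits h') (ch x) else nilp (ch x).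

Lemma walk_rcons x u i : walk x (rcons u i) = nth (walk x u) (ch (walk x u)) i.
Proof. by elim: u x => //= j u IH x. Qed.

Lemma valid_rcons x u i :
  valid x (rcons u i) = valid x u && (i < size (ch (walk x u))).
Proof. by elim: u x => [|j u IH] x /=; rewrite ?andbT // IH andbA. Qed.

Lemma fits_measure (ok : V -> Prop) (mu : V -> nat) h x :
  (forall y z, ok y -> z \in ch y -> ok z /\ mu z < mu y) ->
  ok x -> mu x <= h -> fits h x.
Proof.
move=> H; elim: h x => [|h IH] x okx /= mux.
  by case E: (ch x) => [//|y s]; have [] := H x y okx;
    rewrite ?E ?mem_head //; lia.
by apply/allP => y yx; have [oky muy] := H _ _ okx yx; apply: IH => //; lia.
Qed.

Lemma nth_fits h x i : fits h.+1 x -> i < size (ch x) -> fits h (nth x (ch x)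
  i).
Proof. by move=> /allP/= H ilt; apply/H/mem_nth. Qed.

Lemma subtree_grow h x u : fits h x -> valid x u ->
  exists2 h', fits h' (walk x u) & subtree (grow ch h x) u = grow ch h' (walk x
    u).
Proof.
elim: u h x => [|i u IH] h x; first by exists h.
case: h => [|h] fx /= /andP[ilt vu].
  by move: fx ilt => /nilP ->.
by rewrite (nth_map x) //; apply: IH => //; apply: nth_fits.
Qed.

Lemma outdeg_grow h x u : fits h x -> valid x u ->
  outdeg (grow ch h x) u = size (ch (walk x u)).
Proof.
move=> fx vu; have [h' fh E] := subtree_grow fx vu; rewrite /outdeg E.
by case: h' fh {E} => [/nilP-> //|h' _] /=; rewrite size_map.
Qed.

Lemma verticesE ts : vertices (PNode ts) = [::] ::
  flatten [seq [seq i :: u | u <- vertices (nth (PNode [::]) ts i)]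
          | i <- iota 0 (size ts)].
Proof.
rewrite /=; congr (_ :: flatten _).
transitivity [seq [seq p.1 :: u | u <- p.2] |
  p <- [seq (i, vertices (nth (PNode [::]) ts i)) | i <- iota 0 (size ts)]].
  congr map; apply: (@eq_from_nth _ (0, [::])).
    by rewrite size_zip !size_map size_iota minnn.
  rewrite size_zip size_map size_iota minnn => i ilt.
  by rewrite nth_zip ?size_map ?size_iota // (nth_map 0) ?size_iota // (nth_map
    (PNode [::])) // nth_iota.
by rewrite -map_comp.
Qed.

Lemma mem_vertices_grow h x u : fits h x ->
  (u \in vertices (grow ch h x)) = valid x u.
Proof.
elim: u h x => [|i u IH] h x fx.
  by case: h fx => [|h] fx //=; rewrite inE.
case: h fx => [|h] fx.
  by move: fx => /= /nilP->.
rewrite [grow _ _ _]/= verticesE inE /= size_map.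
apply/flattenP/andP => [[s /mapP[j]]|[ilt vu]].
  rewrite mem_iota => /andP[_ jlt] -> /mapP[w wv [ij uw]]; subst j w;
    split => //.
  by move: wv; rewrite (nth_map x) // IH //; apply: nth_fits.
exists [seq i :: u | u <- vertices (grow ch h (nth x (ch x) i))].
  by apply/mapP; exists i; rewrite ?mem_iota // (nth_map x).
by apply/mapP; exists u => //; rewrite IH //; apply: nth_fits.
Qed.

Lemma map_walk_vertices h x : map (walk x) (vertices (grow ch h x)) = preorder
  h x.
Proof.
elim: h x => [|h IH] x //.
rewrite [grow _ _ _]/= verticesE [map _ _]/= [RHS]/=; congr (_ :: _).
rewrite map_flatten -map_comp size_map; congr flatten.
apply: (@eq_from_nth _ [::]); rewrite !size_map size_iota // => i ilt.
rewrite (nth_map 0) ?size_iota // (nth_map x) // -IH nth_iota //=.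
by rewrite (nth_map x) // -map_comp; apply: eq_map.
Qed.

Lemma preorder_measure (mu : V -> nat) h x :
  (forall y z, z \in ch y -> mu z < mu y) -> mu x <= h ->
  preorder h.+1 x = preorder h x.
Proof.
move=> H; elim: h x => [|h IH] x mux.
  by rewrite /=; case E: (ch x) => [//|y s]; have := H x y;
    rewrite E mem_head => /(_ isT); lia.
congr (_ :: flatten _); apply/eq_in_map => y /H yx; apply: IH; lia.
Qed.

End Grow.

(** This serves twice: to pass from the dual tree to its tree of labels, and from the image of the
    bijection to the tree of a parent function. *)
Lemma grow_simulation (A B : eqType) (chA : A -> seq A) (chB : B -> seq B)
    (ok : A -> Prop) (g : A -> B) :
  (forall x, ok x -> chB (g x) = map g (chA x)) ->
  (forall x y, ok x -> y \in chA x -> ok y) ->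
  forall h x, ok x -> grow chA h x = grow chB h (g x).
Proof.
move=> Hg Hok; elim=> [|h IH] x okx //=.
by rewrite Hg // -map_comp; congr PNode; apply/eq_in_map => y yx;
  apply/IH/(Hok x).
Qed.

Lemma mem_preorder_simulation (A B : eqType) (chA : A -> seq A) (chB : B -> seq
  B)
    (ok : A -> Prop) (g : A -> B) :
  (forall x, ok x -> chB (g x) = map g (chA x)) ->
  (forall x y, ok x -> y \in chA x -> ok y) ->
  forall h x b, ok x -> b \in preorder chB h (g x) -> exists2 a, ok a & b = g a.
Proof.
move=> Hg Hok; elim=> [|h IH] x b okx /=; rewrite inE.
  by move=> /eqP->; exists x.
case/orP => [/eqP->|]; first by exists x.
case/flattenP => s; rewrite Hg // -map_comp => /mapP[y yx ->]; apply: IH.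
exact: Hok yx.
Qed.

(** * Depth-first order of a tree given by its parent function *)

Section ParentFunction.
Variables (n : nat) (par : nat -> nat).
Hypothesis par_lt : forall m, 0 < m <= n -> par m < m.
(** The arcs drawn from each [m] to [par m] do not cross. *)
Hypothesis par_nc : forall m1 m2, 0 < m1 -> m1 < m2 <= n -> par m2 < m1 ->
  par m2 <= par m1.

Definition kids l := [seq m <- iota 1 n | par m == l].

Lemma mem_kids l m : (m \in kids l) = (0 < m <= n) && (par m == l).
Proof. by rewrite mem_filter mem_iota andbC; congr andb; lia. Qed.

Lemma kids_gt l m : m \in kids l -> l < m <= n.
Proof. by rewrite mem_kids => /andP[mn /eqP<-]; have := par_lt mn; lia. Qed.

Lemma kids_sorted l : sorted ltn (kids l).
Proof. by rewrite (sorted_filter ltn_trans) ?iota_ltn_sorted. Qed.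

Lemma fits_kids h : n <= h -> fits kids h 0.
Proof.
move=> nh; apply: (@fits_measure _ _ (fun _ => True) (fun l => n - l)) => //;
  last by lia.
by move=> y z _ /kids_gt; split => //; lia.
Qed.

(* The stack of the depth-first search after the visit of k. *)
Definition pending k := [seq m <- iota k.+1 (n - k) | par m <= k].

(** The vertex k + 1 is on top of the stack and gives way to its children; by [par_nc] these precede
    every vertex that was already pending. *)
Lemma pendingS k : k < n ->
  exists2 s, pending k = k.+1 :: s & pending k.+1 = kids k.+1 ++ s.
Proof.
move=> kn; exists [seq m <- iota k.+2 (n - k.+1) | par m <= k].
  rewrite /pending; have -> : n - k = (n - k.+1).+1 by lia.
  rewrite /=; have -> // : par k.+1 <= k.
  by rewrite -ltnS par_lt.
apply: (irr_sorted_eq ltn_trans ltnn).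
- by rewrite (sorted_filter ltn_trans) ?iota_ltn_sorted.
- rewrite (sorted_pairwise ltn_trans) pairwise_cat -!(sorted_pairwise
  ltn_trans).
  rewrite kids_sorted /= (sorted_filter ltn_trans) ?iota_ltn_sorted ?andbT //.
  apply/allrelP => m1 m2; rewrite mem_kids mem_filter mem_iota.
  move=> /andP[m1n /eqP pm1] /andP[pm2 m2n]; rewrite /mem /=.
  case: (ltngtP m1 m2) => // [m21|E]; last by move: pm1 pm2; rewrite E; lia.
  by have := @par_nc m2 m1; lia.
- move=> m; rewrite mem_cat mem_kids !mem_filter !mem_iota.
  by have := @par_lt m; lia.
Qed.

Lemma preorder_kids h : n <= h -> preorder kids h 0 = iota 0 n.+1.
Proof.
move=> nh.
(* For [h >= n] the truncated recursion agrees with the full one. *)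
have unfold x : preorder kids h x = x :: flatten (map (preorder kids h) (kids
  x)).
  rewrite -(@preorder_measure _ _ (fun l => n - l) h) //; last by lia.
  by move=> y z /kids_gt; lia.
(* Induction on the number [k] of labels still to be visited. *)
have pend k : k <= n -> flatten (map (preorder kids h) (pending (n - k))) =
  iota (n - k).+1 k.
  elim: k => [|k IH] kn.
    by rewrite subn0 /pending subnn.
  have [|s E1 E2] := @pendingS (n - k.+1); first by lia.
  rewrite E1 /= unfold /= -flatten_cat -map_cat -E2.
  have -> : (n - k.+1).+1 = n - k by lia.
  by rewrite IH //; lia.
have := pend n (leqnn _); rewrite subnn => E.
rewrite unfold [RHS]/= -E; congr (_ :: flatten (map _ _)).
by rewrite /pending subn0; apply: eq_in_filter => m _; rewrite leqn0.
Qed.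

End ParentFunction.

(** * Noncrossing partitions of {0, ..., n} *)

Lemma path_ltn_last g s x : path ltn g s -> x \in g :: s -> x <= last g s.
Proof.
elim: s g x => [|y s IH] g x /=; first by rewrite inE => _ /eqP->.
move=> /andP[gy ys]; rewrite inE => /orP[/eqP->|]; last exact: IH.
by apply: leq_trans (ltnW gy) _; apply: IH ys (mem_head _ _).
Qed.

Lemma sorted_ltn_gap s k x : sorted ltn s -> k.+1 < size s ->
  nth 0 s k < x < nth 0 s k.+1 -> x \notin s.
Proof.
move=> /(sorted_ltn_nth ltn_trans 0) srt klt kx;
  apply/negP => /(nthP 0)[j jlt xE].
have [kj|jk] := ltnP k j.
  move: kj; rewrite leq_eqVlt => /orP[/eqP E|kj]; first by move: kx;
    rewrite E xE ltnn andbF.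
  have := srt k.+1 j; rewrite !inE klt jlt => /(_ isT isT kj) /=.
  by rewrite xE ltnNge ltnW //; case/andP: kx.
move: jk; rewrite leq_eqVlt => /orP[/eqP E|jk]; first by move: kx;
  rewrite -E xE ltnn.
have := srt j k; rewrite !inE jlt (ltnW klt) => /(_ isT isT jk) /=.
by rewrite xE ltnNge ltnW //; case/andP: kx.
Qed.

Section Noncrossing.
Variables (T : eqType) (n : nat) (f : nat -> T).
Hypothesis f_nc : forall a b c d, a < b -> b < c -> c < d <= n ->
  f a = f c -> f b = f d -> f a = f b.

(* {g+1, ..., m} is a union of blocks. *)
Definition saturated g m :=
  all (fun a => all (fun b => (f a == f b) ==> (g < b <= m)) (iota 0 n.+1))
    (iota g.+1 (m - g)).

Lemma saturatedP g m :
  reflect (forall a b, g < a <= m -> b <= n -> f a = f b -> g < b <= m)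
    (saturated g m).
Proof.
apply: (iffP allP) => [H a b agm bn fab|H a].
  have /H/allP/(_ b) : a \in iota g.+1 (m - g) by rewrite mem_iota; lia.
  by rewrite mem_iota fab eqxx; apply; lia.
rewrite mem_iota => agm; apply/allP => b; rewrite mem_iota => bn.
by apply/implyP => /eqP; apply: H; lia.
Qed.

Lemma saturated_refl g : saturated g g.
Proof. by apply/saturatedP => a b; lia. Qed.

Lemma saturated_trans g m k : g <= m <= k -> saturated g m -> saturated m k ->
  saturated g k.
Proof.
move=> gmk /saturatedP gm /saturatedP mk; apply/saturatedP => a b agk bn fab.
have [am|am] := leqP a m.
  by have := gm a b ltac:(lia) bn fab; lia.
by have := mk a b ltac:(lia) bn fab; lia.
Qed.

Lemma saturated_cancel g m k : g <= m -> m <= k <= n -> saturated g m ->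
  saturated g k -> saturated m k.
Proof.
move=> gm0 mk /saturatedP gm /saturatedP gk; apply/saturatedP => a b amk bn fab.
have gbk := gk a b ltac:(lia) bn fab.
have [bm|] := leqP b m; last by lia.
have an : a <= n by lia.
by have := gm b a ltac:(lia) an (esym fab); lia.
Qed.

Definition is_min m := forall a, a <= n -> f a = f m -> m <= a.
Definition is_max m := forall a, a <= n -> f a = f m -> a <= m.

Lemma exists_min m : m <= n -> exists2 b, b <= m & f b = f m /\ is_min b.
Proof.
move=> mn; have ex : exists b, f b == f m by exists m.
have [b /eqP fb minb] := ex_minnP ex.
exists b; first exact: minb; split=> // a an fa.
by apply: minb; rewrite fa fb.
Qed.

Lemma exists_max m : m <= n -> exists2 b, m <= b <= n & f b = f m /\ is_max b.
Proof.
move=> mn; have ex : exists b, (b <= n) && (f b == f m) by exists m;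
  rewrite mn /=.
have bnd b : (b <= n) && (f b == f m) -> b <= n by case/andP.
have [b /andP[bn /eqP fb] maxb] := ex_maxnP ex bnd.
exists b; first by rewrite bn andbT; apply: maxb; rewrite mn /=.
by split=> // a an fa; apply: maxb; rewrite an fa fb /=.
Qed.

Lemma exists_next m s : m < s -> f s = f m ->
  exists2 s', m < s' <= s & f s' = f m /\ forall a, m < a < s' -> f a <> f m.
Proof.
move=> ms fs; have ex : exists s, (m < s) && (f s == f m) by exists s;
  rewrite ms /=; exact/eqP.
have [b /andP[mb /eqP fb] minb] := ex_minnP ex.
exists b; first by rewrite mb minb // ms /=; apply/eqP.
split=> // a amb fa; have : b <= a by apply: minb; rewrite fa eqxx andbT; lia.
lia.
Qed.

(** A block with an element strictly between [b] and [q] and another one outside would interlace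
    with the block of [b] and [q], hence be equal to it, against the extremality of [b] and [q]. *)
Lemma saturated_span b q : q <= n -> is_min b -> is_max q -> f b = f q ->
  0 < b -> saturated b.-1 q.
Proof.
move=> qn minb maxq fbq b0; apply/saturatedP => a c abq cn fac.
have [E|ab] := eqVneq a b.
  by have := minb c cn; have := maxq c cn;
    rewrite -fac E fbq => /(_ erefl) + /(_ erefl); lia.
have [E|aq] := eqVneq a q.
  by have := minb c cn; have := maxq c cn;
    rewrite -fac E fbq => /(_ erefl) + /(_ erefl); lia.
have [cb|cb] := ltnP c b.
  have E : f c = f b by apply: (@f_nc c b a q) => //; lia.
  by have := minb c cn E; lia.
have [cq|cq] := leqP c q; first by lia.
have E : f b = f a by apply: (@f_nc b a q c) => //; lia.
by have := maxq c cn; rewrite -fac -E fbq => /(_ erefl); lia.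
Qed.

(** Same argument as for [saturated_span], with two consecutive elements of a block instead of its
    extremes. *)
Lemma saturated_gap m s : m < s <= n -> f s = f m ->
  (forall a, m < a < s -> f a <> f m) -> saturated m s.-1.
Proof.
move=> ms fs gap; apply/saturatedP => a b ams bn fab.
have fam := gap a ltac:(lia).
have [E|bm] := eqVneq b m; first by case: fam; rewrite fab E.
have [E|bs] := eqVneq b s; first by case: fam; rewrite fab E.
have [bltm|] := ltnP b m.
  by have := @f_nc b m a s; rewrite -fab => E; case: fam; apply: E => //; lia.
have [sb|] := ltnP s b; last by lia.
by have := @f_nc m a s b; rewrite -fab => E; case: fam; rewrite E => //; lia.
Qed.

(** When [q] is the largest element of its block and [g] the smallest label of its face, these lists
    are the remaining labels, that is, the edges to the children. *)
Definition block_below q := [seq m <- iota 0 q | f m == f q].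
Definition face_above g := [seq m <- iota g.+1 (n - g) | saturated g m].

Lemma mem_block_below q m : (m \in block_below q) = (m < q) && (f m == f q).
Proof. by rewrite mem_filter mem_iota andbC. Qed.

Lemma mem_face_above g m : (m \in face_above g) = (g < m <= n) && saturated g m.
Proof. by rewrite mem_filter mem_iota andbC; congr andb; lia. Qed.

Lemma head_block_below q b : b <= q -> q <= n -> f b = f q -> is_min b ->
  head q (block_below q) = b.
Proof.
move=> bq qn fb minb; have := mem_block_below q.
have := iota_ltn_sorted 0 q; move/(sorted_filter ltn_trans (fun m => f m == f
  q)).
rewrite -/(block_below q); case: (block_below q) => [_ /(_ b)|x s] /=.
  by rewrite fb eqxx in_nil; lia.
rewrite (path_sortedE ltn_trans) => /andP[/allP xs _] mem.
have := mem x; rewrite mem_head => /esym/andP[xq /eqP fx].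
have bx : b <= x by apply: minb; [lia | rewrite fx fb].
have := mem b; rewrite fb eqxx andbT inE => E.
have [//|bx'] := eqVneq x b.
have bs : b \in s by move: E; rewrite eq_sym (negbTE bx') /=; lia.
by have := xs b bs; rewrite /=; lia.
Qed.

Lemma face_above_sorted g : sorted ltn (g :: face_above g).
Proof.
rewrite /= (path_sortedE ltn_trans) (sorted_filter ltn_trans) ?iota_ltn_sorted
  // andbT.
by apply/allP => m; rewrite mem_face_above /= => /andP[]; lia.
Qed.

(* Between two consecutive elements q < q' of a face, the span of the block of
   q + 1 is saturated, hence ends at an element of the face, that is at q'. *)
Lemma face_consecutive g i : i < size (face_above g) ->
  let q := nth 0 (g :: face_above g) i in
  let q' := nth 0 (face_above g) i in
  [/\ g <= q, q < q' <= n, is_min q.+1, is_max q' & f q.+1 = f q'].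
Proof.
move=> ilt q q'.
have srt := sorted_ltn_nth ltn_trans 0 (face_above_sorted g).
have q'E : q' = nth 0 (g :: face_above g) i.+1 by [].
have qq' : q < q' by rewrite q'E; apply: srt => //; rewrite inE /=; lia.
have /[!mem_face_above]/andP[gq' cq'] : q' \in face_above g by exact: mem_nth.
have cq : saturated g q /\ g <= q.
  rewrite /q; case: i ilt {q q' q'E qq' gq' cq'} => [|i] ilt /=;
    first by rewrite saturated_refl.
  have : nth 0 (face_above g) i \in face_above g by apply/mem_nth/ltnW.
  by rewrite mem_face_above => /andP[/andP[gx _] cx]; split=> //; exact: ltnW.
have cqq' : saturated q q' by apply: saturated_cancel (proj1 cq) cq'; lia.
have none x : q < x < q' -> ~~ saturated g x.
  move=> xq; apply/negP => cx; have [ilt' gx] : i.+1 < size (g :: face_above g)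
    /\ g < x by split=> //; lia.
  have /negP := sorted_ltn_gap (face_above_sorted g) ilt' xq.
  by apply; rewrite inE mem_face_above cx; lia.
have minq : is_min q.+1.
  by move=> a an fa; have := elimT (saturatedP _ _) cqq' q.+1 a ltac:(lia) an
    (esym fa); lia.
have [M Mq' [fM maxM]] : exists2 b, q.+1 <= b <= n & f b = f q.+1 /\ is_max b.
  by apply: exists_max; lia.
have Mle : M <= q'.
  have Mn : M <= n by lia.
  by have := elimT (saturatedP _ _) cqq' q.+1 M ltac:(lia) Mn (esym fM); lia.
have cM : saturated q M by rewrite -[q]/(q.+1.-1);
  apply: saturated_span => //; lia.
have E : M = q'.
  apply/eqP; rewrite eqn_leq Mle leqNgt; apply/negP => Mlt.
  by have /negP := none M ltac:(lia); apply; apply: saturated_trans cM;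
    [lia|exact: (proj1 cq)].
by split=> //; rewrite -?E //; lia.
Qed.

(** The gap before [s] is a union of blocks, so s - 1 belongs to the face; a larger label would
    enclose [s] without [g], although both are in one block. *)
Lemma face_last g s : g < s <= n -> f s = f g ->
  (forall a, g < a < s -> f a <> f g) -> last g (face_above g) = s.-1.
Proof.
move=> gs fs gap; have cgs := saturated_gap gs fs gap.
have le m : m \in face_above g -> m < s.
  rewrite mem_face_above => /andP[gm /saturatedP H]; rewrite ltnNge;
    apply/negP => sm.
  have gn : g <= n by lia.
  by have := H s g ltac:(lia) gn fs; lia.
have sg : s.-1 \in g :: face_above g by rewrite inE mem_face_above cgs; lia.
apply/eqP; rewrite eqn_leq (path_ltn_last (face_above_sorted g)) // andbT.
by have := mem_last g (face_above g); move: (last _ _) => x;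
  rewrite inE => /orP[/eqP->|/le]; lia.
Qed.

(** Written with [head m] so as to match the vertex c(v) of the bijection: the first child if there
    is one, and otherwise the vertex itself. *)
Definition block_min m := head m (block_below m).

Lemma block_minE b q : b <= q -> q <= n -> f b = f q -> is_min b -> block_min q
  = b.
Proof. exact: head_block_below. Qed.

Lemma block_minP m : m <= n ->
  [/\ block_min m <= m, f (block_min m) = f m & is_min (block_min m)].
Proof.
by move=> mn; have [b bm [fb minb]] := exists_min mn; rewrite (block_minE bm).
Qed.

Lemma eq_block_min m k : m <= n -> k <= n -> (block_min m == block_min k) = (f
  m == f k).
Proof.
move=> mn kn; have [bm fm minm] := block_minP mn;
  have [bk fk mink] := block_minP kn.
apply/eqP/eqP => [E|E]; first by rewrite -fm E.
apply/eqP; rewrite eqn_leq; apply/andP; split.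
  by apply: minm; [exact: leq_trans bk kn | rewrite fk -E].
by apply: mink; [exact: leq_trans bm mn | rewrite fm E].
Qed.

(** In [iota 0 m] a position is equal to the element found there. The search succeeds because a = m
    - 1 gives an empty interval. *)
Definition outer m := find (fun a => saturated a m.-1) (iota 0 m).

Lemma outerP m : 0 < m ->
  [/\ outer m < m, saturated (outer m) m.-1 & forall a, a < outer m -> ~~
    saturated a m.-1].
Proof.
move=> m0; have H : has (fun a => saturated a m.-1) (iota 0 m).
  by apply/hasP; exists m.-1; rewrite ?saturated_refl // mem_iota; lia.
have lt : outer m < m by have := H; rewrite has_find size_iota.
split=> // [|a alt]; first by have := nth_find 0 H; rewrite nth_iota.
by have := before_find 0 alt; rewrite nth_iota ?add0n => [->//|]; lia.
Qed.

Lemma outerE a m : a < m -> saturated a m.-1 -> (forall b, b < a -> ~~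
  saturated b m.-1) ->
  outer m = a.
Proof.
move=> am ca mina; have [om co mino] := outerP (leq_ltn_trans (leq0n a) am).
apply/eqP; rewrite eqn_leq; apply/andP; split; rewrite leqNgt; apply/negP.
  by move=> /mino; rewrite ca.
by move=> /mina; rewrite co.
Qed.

(** If a < g, a union of blocks {a+1, ..., m-1} contains [g] and hence [s], whereas {g+1, ..., m-1}
    cannot contain [s] without [g]. *)
Lemma outer_next g s m : g < s <= n -> f s = f g -> 0 < m <= n ->
  (outer m == g) = (g < m) && saturated g m.-1.
Proof.
move=> gs fs mn; have /outerP[om co _] : 0 < m by lia.
apply/eqP/andP => [<- //|[gm cg]]; apply: outerE => // b bg.
apply/negP => /saturatedP cb.
have sg : f g = f s by []; have sn : s <= n by lia.
have bs := cb g s ltac:(lia) sn sg.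
have gn : g <= n by lia.
by have := elimT (saturatedP _ _) cg s g ltac:(lia) gn fs; lia.
Qed.

(** If the block ending at [outer m] avoids 0, its span can be glued to the left of the interval
    that defines [outer m], against minimality. *)
Lemma is_max_outer m : 0 < m <= n -> is_max (outer m) -> f 0 = f (outer m).
Proof.
move=> mn maxq; have /outerP[om co mino] : 0 < m by lia.
have [bq fb minb] := block_minP (m := outer m) ltac:(lia).
have [b0|b0] := posnP (block_min (outer m)); first by rewrite -fb b0.
have cspan := saturated_span (q := outer m) ltac:(lia) minb maxq fb b0.
have /negP[] := mino (block_min (outer m)).-1 ltac:(lia).
by apply: saturated_trans co => //; lia.
Qed.

End Noncrossing.

(** * The Janson-Stefansson bijection *)

Lemma parent_rcons u k : parent (rcons u k) = u.
Proof. by rewrite /parent size_rcons -cats1 take_size_cat. Qed.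

Section JansonStefansson.
Variables (V : eqType) (ch : V -> seq V) (ok even : V -> Prop) (mu : V -> nat).
Hypothesis ch_step : forall x y, ok x -> y \in ch x ->
  ok y /\ mu y < mu x.
Variables (h : nat) (r : V).
Hypotheses (ok_r : ok r) (mu_r : mu r <= h).
Let t := grow ch h r.

Let fits_r : fits ch h r.
Proof. exact: fits_measure ch_step ok_r mu_r. Qed.

Lemma ok_walk u : valid ch r u -> ok (walk ch r u).
Proof.
elim/last_ind: u => [|u k IH] //;
  rewrite valid_rcons walk_rcons => /andP[/IH oku klt].
by have [] := ch_step oku (mem_nth (walk ch r u) klt).
Qed.

Lemma walk_first_child u : valid ch r u ->
  let y := walk ch r u in
  valid ch r (first_child_or_self t u) /\
  walk ch r (first_child_or_self t u) = head y (ch y).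
Proof.
move=> vu y; rewrite /first_child_or_self outdeg_grow // -/y -nth0.
case E: (size (ch y)) => [|k]; first by rewrite nth_default ?E.
by rewrite valid_rcons walk_rcons vu -/y E.
Qed.

(* The default value of nth accounts for the last child being the parent when
   there is no next sibling. *)
Lemma walk_js_children u k : valid ch r (rcons u k) -> odd (size (rcons u k)) ->
  let x := walk ch r u in
  let y := nth x (ch x) k in
  map (walk ch r) (js_children t (rcons u k)) =
  rcons [seq head z (ch z) | z <- ch y] (nth x (ch x) k.+1).
Proof.
move=> vk oddv x y; rewrite /js_children oddv map_rcons.
have /andP[vu klt] : valid ch r u && (k < size (ch x)) by rewrite -valid_rcons.
rewrite parent_rcons /next_sibling parent_rcons last_rcons !outdeg_grow // -/x.
rewrite walk_rcons -/x -/y -map_comp; congr rcons; last first.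
  by case: ltnP => kx; rewrite ?walk_rcons // nth_default.
apply: (@eq_from_nth _ y); rewrite !size_map size_iota // => i ilt.
rewrite (nth_map 0) ?size_iota // nth_iota // add0n (nth_map y) //=.
have [|_ ->] := @walk_first_child (rcons (rcons u k) i).
  by rewrite valid_rcons vk walk_rcons -/x -/y.
by rewrite !walk_rcons -/x -/y.
Qed.

Lemma valid_js_children v w : valid ch r v -> w \in js_children t v -> valid ch
  r w.
Proof.
rewrite /js_children; case: ifP => //; elim/last_ind: v => [//|u k _] _ vk.
move: (vk); rewrite valid_rcons => /andP[vu klt].
rewrite mem_rcons inE => /orP[/eqP->|/mapP[i]].
  rewrite parent_rcons /next_sibling parent_rcons last_rcons outdeg_grow //.
  by case: ifP => // kx; rewrite valid_rcons vu.
rewrite mem_iota outdeg_grow ?valid_rcons ?vu // => /andP[_ ilt] ->.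
by have [] := @walk_first_child (rcons (rcons u k) i);
  rewrite ?valid_rcons ?vu ?klt.
Qed.

Variables (n : nat) (par : nat -> nat) (idx : V -> nat).
Hypothesis par_lt : forall m, 0 < m <= n -> par m < m.
Hypothesis par_nc : forall m1 m2, 0 < m1 -> m1 < m2 <= n -> par m2 < m1 ->
  par m2 <= par m1.
(** The predicate [even] bears on nodes alone and stands for even generation; for the dual tree it
    is a colour. *)
Hypothesis even_root : even r.
Hypothesis even_step : forall x y z, even x -> y \in ch x -> z \in ch y -> even
  z.
(** The list passed to [idx] consists of the children of [y] in the image of the bijection, the
    default [x] of [nth] being the parent of [y]. This hypothesis and the next say that [idx] turns
    the image into the tree of [par]. *)
Hypothesis idx_odd : forall x k, ok x -> even x -> k < size (ch x) ->
  let y := nth x (ch x) k in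
  map idx (rcons [seq head z (ch z) | z <- ch y] (nth x (ch x) k.+1)) =
  kids n par (idx y).
Hypothesis idx_even : forall x, ok x -> even x -> kids n par (idx x) = [::].
Hypothesis ch_root : 0 < size (ch r).
Hypothesis idx_root : idx (nth r (ch r) 0) = 0.

Let even_walk u : valid ch r u -> ~~ odd (size u) -> even (walk ch r u).
Proof.
have [m] := ubnP (size u); elim: m u => // m IH u um.
elim/last_ind: u um => [//|u i _]; elim/last_ind: u => [|u j _] //.
rewrite !size_rcons !ltnS !valid_rcons !walk_rcons /= negbK.
move=> um /andP[/andP[vu jlt] ilt] odu.
by apply: even_step (IH u _ vu odu) (mem_nth _ jlt) (mem_nth _ ilt);
  exact: ltnW.
Qed.

Let simulation u : valid ch r u ->
  kids n par (idx (walk ch r u)) = map (idx \o walk ch r) (js_children t u).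
Proof.
move=> vu; case E: (odd (size u)); last first.
  by rewrite /js_children E idx_even //; [exact: ok_walk | apply: even_walk;
    rewrite ?E].
elim/last_ind: u vu E => [//|u k _] vk E.
rewrite map_comp walk_js_children // idx_odd ?walk_rcons //;
  move: (vk); rewrite valid_rcons => /andP[vu klt] //; first exact: ok_walk.
by apply: even_walk => //; move: E; rewrite size_rcons.
Qed.

Theorem janson_stefansson_grow :
  exists2 H, n <= H & janson_stefansson t = grow (kids n par) H 0.
Proof.
exists (size (vertices t)); last first.
  have -> : janson_stefansson t = grow (js_children t) (size (vertices t)) [::
    0].
    rewrite /t; case: h fits_r => [/nilP|h' _] /=;
      first by rewrite /nilp => E; move: ch_root; rewrite E.
    by case: (ch r) ch_root.
  rewrite (@grow_simulation _ _ _ (kids n par) (valid ch r) (idx \o walk ch r))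
    /=.
  - by rewrite idx_root.
  - exact: simulation.
  - exact: valid_js_children.
  - by rewrite ch_root.
(* The truncation height is large enough because all n + 1 labels are reached
   from distinct vertices of t. *)
suff /(uniq_leq_size (iota_uniq 0 n.+1)) : {subset iota 0 n.+1 <= map (idx \o
  walk ch r) (vertices t)}.
  by rewrite size_iota size_map; apply: ltnW.
move=> l; rewrite -(preorder_kids par_lt par_nc (leqnn n)) -[X in preorder _ _
  X]idx_root => lpre.
have [|u vu ->] := mem_preorder_simulation (chA := js_children t)
  (g := idx \o walk ch r) (ok := valid ch r) simulation valid_js_children _
    lpre (x := [:: 0]).
  by rewrite /= ch_root.
by apply: map_f; rewrite mem_vertices_grow.
Qed.

End JansonStefansson.

(** * The image of the dual tree *)

Section AbstractDual.
Variables (T : eqType) (n : nat) (f : nat -> T).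
Hypothesis f_nc : forall a b c d, a < b -> b < c -> c < d <= n ->
  f a = f c -> f b = f d -> f a = f b.

Local Notation saturated := (saturated n f).
Local Notation is_min := (is_min n f).
Local Notation is_max := (is_max n f).
Local Notation block_below := (block_below f).
Local Notation face_above := (face_above n f).
Local Notation block_min := (block_min f).
Local Notation outer := (outer n f).

(* T(P), where (Black, q) and (White, g) stand for the vertices whose edge to
   their parent has label q, resp. g: q is the largest element of its block and
   g the smallest label of its face. *)
Definition dual_step (x : colour * nat) : seq (colour * nat) :=
  match x.1 with
  | Black => [seq (White, m) | m <- block_below x.2]
  | White => [seq (Black, m) | m <- face_above x.2]
  end.

(** Invariant along the tree: a black label is the largest of its block, and a nonzero white label
    [g] is followed by a later element of its block, which is the parent of the face. *)
Definition dual_ok (x : colour * nat) : Prop :=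
  x.2 <= n /\
  match x.1 with
  | Black => is_max x.2
  | White => x.2 = 0 \/ exists2 s, x.2 < s <= n & f s = f x.2
  end.

(* The width of the interval of labels covered by a subtree. *)
Definition dual_span (x : colour * nat) : nat :=
  match x.1 with
  | Black => (x.2 - block_min x.2).+1
  | White => (last x.2 (face_above x.2) - x.2).+1
  end.

Lemma last_face_above g s : s <= n -> f s = f g -> g < s -> last g (face_above
  g) < s.
Proof.
move=> sn fs gs; have [s' gs' [fs' gap]] := exists_next gs fs.
by rewrite (@face_last _ _ _ f_nc g s') //; lia.
Qed.

(** The width decreases since a block below the face of [g] starts after [g], and a face below a
    block ends before the next element of that block. *)
Lemma dual_step_ok x y : dual_ok x -> y \in dual_step x ->
  dual_ok y /\ dual_span y < dual_span x.
Proof.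
case: x => [[] l] /= [/= ln okl]; rewrite /dual_step /=.
  move=> /mapP[q]; rewrite mem_face_above => /andP[lq cq] ->.
  have /andP[_ qn] := lq.
  split.
    by split=> //= a an fa; have := elimT (saturatedP _ _ _ _) cq q a
      ltac:(lia) an (esym fa); lia.
  rewrite /dual_span /=; have [bq fb minb] := block_minP f qn.
  have bn : block_min q <= n by exact: leq_trans bq qn.
  have := elimT (saturatedP _ _ _ _) cq q _ ltac:(lia) bn (esym fb).
  have : q <= last l (face_above l).
    by apply: path_ltn_last (face_above_sorted _ _ l) _;
      rewrite inE mem_face_above lq cq orbT.
  lia.
move=> /mapP[m]; rewrite mem_block_below => /andP[ml /eqP fm] ->.
split.
  by split=> /=; [lia | right; exists l => //; rewrite ml].
rewrite /dual_span /=; have [bq fb minb] := block_minP f ln.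
have := last_face_above ln (esym fm) ml.
have := minb m ltac:(lia); rewrite fb => /(_ fm).
lia.
Qed.

Lemma dual_span_le x : dual_ok x -> dual_span x <= n.+1.
Proof.
case: x => [[] l] [/= ln _]; rewrite /dual_span /=; last by lia.
by have := mem_last l (face_above l); move: (last _ _) => z;
  rewrite inE mem_face_above => /orP[/eqP->|]; lia.
Qed.

Lemma block_min_face g i : i < size (face_above g) ->
  block_min (nth 0 (face_above g) i) = (nth 0 (g :: face_above g) i).+1.
Proof.
move=> ilt; have [_ /andP[qq' q'n] minq _ E] := @face_consecutive _ _ _ f_nc g
  i ilt.
exact: block_minE qq' q'n E minq.
Qed.

Lemma rcons_block_below_sorted q : sorted ltn (rcons (block_below q) q).
Proof.
rewrite -cats1 (sorted_pairwise ltn_trans) pairwise_cat -!(sorted_pairwise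
  ltn_trans).
rewrite (sorted_filter ltn_trans) ?iota_ltn_sorted // !andbT allrel1r.
by apply/allP => m; rewrite mem_block_below => /andP[].
Qed.

Lemma even_step (c : colour) x y z :
  x.1 = c -> y \in dual_step x -> z \in dual_step y -> z.1 = c.
Proof. by case: x => -[] l /= <- /mapP[? _ ->] /mapP[? _ ->]. Qed.

(** * Image of the tree rooted at a white vertex *)

Section WhiteRoot.
Hypothesis f0_single : forall a, 0 < a <= n -> f a <> f 0.

Definition white_parent m := (block_min m).-1.

(* The depth-first index that a vertex of T(P) gets in its image. For the black
   root, the index is the label itself. *)
Definition white_index (x : colour * nat) : nat :=
  match x.1 with
  | Black => (block_min x.2).-1
  | White => last x.2 (face_above x.2)
  end.

Lemma block_min_gt0 m : 0 < m <= n -> 0 < block_min m.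
Proof.
move=> mn; have /(block_minP f)[_ fb _] : m <= n by lia.
by rewrite lt0n; apply/negP => /eqP b0; apply: (f0_single mn); rewrite -fb b0.
Qed.

Lemma white_parent_lt m : 0 < m <= n -> white_parent m < m.
Proof.
move=> mn; have := block_min_gt0 mn; have /(block_minP f)[] : m <= n by lia.
by rewrite /white_parent; lia.
Qed.

Lemma white_parent_eq m k : 0 < m <= n -> 0 < k <= n ->
  (white_parent m == white_parent k) = (f m == f k).
Proof.
move=> mn kn; rewrite -(@eq_block_min _ n f m k); [|lia|lia].
by rewrite /white_parent -eqSS !prednK ?block_min_gt0.
Qed.

(** Otherwise the minimum of the block of [m1], that of the block of [m2], then [m1] and [m2] come
    in this order, and the two blocks interlace. *)
Lemma white_parent_nc m1 m2 : 0 < m1 -> m1 < m2 <= n -> white_parent m2 < m1 ->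
  white_parent m2 <= white_parent m1.
Proof.
move=> m1g m12; rewrite /white_parent => lt.
have m2n : 0 < m2 <= n by lia. have m1n : 0 < m1 <= n by lia.
have b2 := block_min_gt0 m2n; have b1 := block_min_gt0 m1n.
have [bm2 f2 min2] := block_minP (n := n) (m := m2) f ltac:(lia).
have [bm1 f1 min1] := block_minP (n := n) (m := m1) f ltac:(lia).
suff : ~ block_min m1 < block_min m2 by lia.
move=> b12; have [E|ne] := eqVneq (block_min m2) m1.
  have : block_min m1 == block_min m2.
    by rewrite (@eq_block_min _ n f) -?f2 ?E //; lia.
  by lia.
have E : f (block_min m1) = f (block_min m2).
  by apply: (@f_nc _ _ m1 m2) => //; lia.
by have := min2 (block_min m1) ltac:(lia) E; lia.
Qed.

(** The first block below the face of [b] starts at b + 1, so its index is [b]; a face without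
    children has [b] as its last label. *)
Lemma white_index_first b : white_index (head (White, b) (dual_step (White,
  b))) = b.
Proof.
have := @block_min_face b 0; rewrite /dual_step /=.
case E: (face_above b) => [|q s] /=; first by rewrite /white_index /= E.
by move=> /(_ isT); rewrite /white_index /= => ->.
Qed.

(** The faces below the block of [q] contribute its elements other than [q]. The next sibling starts
    at q + 1 and so has index [q]; when there is none, [q] is the last label of the parent face,
    which is its index. Together these are the whole block, whose elements are the children of its
    minimum minus 1. *)
Lemma white_index_odd x k : dual_ok x -> x.1 = White -> k < size (dual_step x)
  ->
  let y := nth x (dual_step x) k in
  map white_index (rcons [seq head z (dual_step z) | z <- dual_step y]
    (nth x (dual_step x) k.+1)) = kids n white_parent (white_index y).
Proof.
case: x => -[] g [/= gn _] //= _; rewrite /dual_step /= size_map => klt.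
rewrite (nth_map 0) //=; set q := nth 0 _ k.
have /[!mem_face_above]/andP[gq cq] : q \in face_above g by exact: mem_nth.
have /andP[_ qn] := gq; have q0 : 0 < q <= n by lia.
rewrite map_rcons -!map_comp.
rewrite (_ : map _ (block_below q) = block_below q); last first.
  by rewrite -[RHS]map_id; apply: eq_map => b; exact: white_index_first.
have -> : white_index (nth (White, g) [seq (Black, m) | m <- face_above g]
  k.+1) = q.
  have [k1|k1] := ltnP k.+1 (size (face_above g)).
    by rewrite (nth_map 0) // /white_index /= block_min_face.
  rewrite nth_default ?size_map // /white_index /= (last_nth 0).
  by have -> : size (face_above g) = k.+1 by apply/eqP; rewrite eqn_leq klt k1.
apply: (irr_sorted_eq ltn_trans ltnn);
  [exact: rcons_block_below_sorted|exact: kids_sorted|].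
move=> m; rewrite mem_rcons inE mem_block_below mem_kids.
apply/idP/andP => [H|[mn]]; last first.
  rewrite [_ == white_index _](white_parent_eq mn q0) => /eqP fm;
    rewrite fm eqxx andbT.
  have /andP[_ mn'] := mn.
  by have := elimT (saturatedP _ _ _ _) cq q m ltac:(lia) mn' (esym fm); lia.
have fm : f m = f q by case/orP: H => [/eqP->|/andP[_ /eqP]].
have m0 : 0 < m by rewrite lt0n; apply/negP => /eqP m0; apply: (f0_single q0);
  rewrite -fm m0.
have mn : 0 < m <= n by lia.
by split=> //; rewrite [_ == white_index _](white_parent_eq mn q0) fm.
Qed.

(** A child of the last label [M] would lie in a block starting at M + 1; the end of that block
    would be a label of the face beyond [M]. *)
Lemma white_index_even x : dual_ok x -> x.1 = White -> kids n white_parent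
  (white_index x) = [::].
Proof.
case: x => -[] g [/= gn _] //= _; set M := white_index _.
apply/eqP; rewrite -[_ == _]negbK -has_filter -all_predC; apply/allP => m.
rewrite mem_iota => mn /=; apply/negP => /eqP.
have m0 : 0 < m <= n by lia.
have b0 := block_min_gt0 m0; rewrite /white_parent => E.
have mn' : m <= n by lia.
have [bm fb minb] := block_minP f mn'.
have [q mq [fq maxq]] := exists_max f mn'.
have cspan : saturated (block_min m).-1 q.
  by apply: saturated_span => //; [lia | rewrite fb].
have cM : g <= M /\ saturated g M.
  rewrite /M /white_index /=; have := mem_last g (face_above g).
  by rewrite inE mem_face_above => /orP[/eqP->|/andP[/andP[/ltnW]]] //;
    rewrite leqnn saturated_refl.
have qM : q \in g :: face_above g.
  rewrite inE mem_face_above (@saturated_trans _ _ _ g M q);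
    [lia|lia|exact: (proj2 cM)|].
  by rewrite -E.
by have := path_ltn_last (face_above_sorted n f g) qM; rewrite -[last _ _]/M;
  lia.
Qed.

Theorem janson_stefansson_white : 0 < n -> exists2 H, n <= H &
  janson_stefansson (grow dual_step n.+1 (White, 0)) = grow (kids n
    white_parent) H 0.
Proof.
(* As 0 is alone in its block, {1, ..., n} is a union of blocks and the root has a child. *)
move=> n_gt0; have fa0 : 0 < size (face_above 0).
  have : n \in face_above 0.
    rewrite mem_face_above n_gt0 leqnn /=; apply/saturatedP => a b an bn fab.
    rewrite bn andbT lt0n; apply/negP => /eqP b0.
    by apply: (f0_single an); rewrite fab b0.
  by case: (face_above 0).
have ok0 : dual_ok (White, 0) by split=> //; left.
apply: (janson_stefansson_grow (even := fun x => x.1 = White) (idx :=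
  white_index)
          dual_step_ok ok0 (dual_span_le ok0) white_parent_lt white_parent_nc)
            => //.
- exact: even_step.
- exact: white_index_odd.
- exact: white_index_even.
- by rewrite /dual_step size_map.
- by rewrite /dual_step /= (nth_map 0) // /white_index /= block_min_face.
Qed.

End WhiteRoot.

(** * Image of the tree rooted at a black vertex *)

Section BlackRoot.
Hypothesis f0_last : f 0 = f n.

(** If [outer m1 < outer m2], the intervals that define them overlap or are adjacent, and their
    union contradicts the minimality of [outer m2]. *)
Lemma outer_nc m1 m2 : 0 < m1 -> m1 < m2 <= n -> outer m2 < m1 -> outer m2 <=
  outer m1.
Proof.
move=> m1g m12 o2; have m20 : 0 < m2 by lia.
have [lt2 c2 min2] := outerP n f  m20.
have [lt1 c1 _] := outerP n f m1g.
rewrite leqNgt; apply/negP => o12; have /negP := min2 _ o12; apply.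
apply/saturatedP => a b am bn fab; have [am1|am1] := ltnP a m1.
  by have := elimT (saturatedP _ _ _ _) c1 a b ltac:(lia) bn fab; lia.
by have := elimT (saturatedP _ _ _ _) c2 a b ltac:(lia) bn fab; lia.
Qed.

(** A child of [q] would put [q] in the block of 0, whose largest element is n; but [q] is smaller
    than its child. *)
Lemma outer_max_kids q : is_max q -> kids n outer q = [::].
Proof.
move=> maxq; apply/eqP; rewrite -[_ == _]negbK -has_filter -all_predC;
  apply/allP => m.
rewrite mem_iota => mn /=; apply/negP => /eqP E.
have mn' : 0 < m <= n by lia.
have := is_max_outer f_nc mn'; rewrite E => /(_ maxq) => fq.
have := maxq n (leqnn n); rewrite -fq f0_last => /(_ erefl).
have m0 : 0 < m by lia.
by have [] := outerP n f m0; lia.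
Qed.

(** The default [q] is the right value past the end, since [q] itself follows the last entry of
    [block_below q]. *)
Lemma nth_block_below_next q k : k < size (block_below q) ->
  let g := nth 0 (block_below q) k in
  let s := nth q (block_below q) k.+1 in
  [/\ g < s <= q, f s = f g & forall a, g < a < s -> f a <> f g].
Proof.
move=> klt g s.
have gE : g = nth 0 (rcons (block_below q) q) k by rewrite nth_rcons klt.
have sE : s = nth 0 (rcons (block_below q) q) k.+1.
  rewrite nth_rcons /s; case: ltnP => [k1|k1]; first exact: set_nth_default.
  by rewrite nth_default // (_ : k.+1 == size _) //; apply/eqP/anti_leq;
    rewrite klt k1.
have srt := rcons_block_below_sorted q.
have k1 : k.+1 < size (rcons (block_below q) q) by rewrite size_rcons ltnS.
have gs : g < s.
  by rewrite gE sE; apply: (sorted_ltn_nth ltn_trans 0 srt);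
    rewrite ?inE // ltnW.
have /[!mem_block_below]/andP[gq /eqP fg] : g \in block_below q by exact:
  mem_nth.
have sq : s \in rcons (block_below q) q by rewrite sE mem_nth.
move: sq; rewrite mem_rcons inE mem_block_below => sq.
have fs : f s = f q by case/orP: sq => [/eqP->|/andP[_ /eqP]].
split; rewrite ?fg //; first by lia.
move=> a ags fa; have := sorted_ltn_gap srt k1;
  rewrite -gE -sE => /(_ a ags) /negP; apply.
by rewrite mem_rcons inE mem_block_below fa eqxx andbT; lia.
Qed.

Lemma kids_outer g s : g < s <= n -> f s = f g ->
  kids n outer g = map succn (g :: face_above g).
Proof.
move=> gs fs; apply: (irr_sorted_eq ltn_trans ltnn); first exact: kids_sorted.
  by rewrite sorted_map; exact: face_above_sorted.
case=> [|m]; rewrite mem_kids.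
  by apply/esym/negbTE/mapP => -[].
rewrite (mem_map succn_inj) inE mem_face_above.
have [mn|mn] := ltnP m n; last first.
  rewrite andbF; apply/esym/negbTE/negP => /orP[/eqP|/andP[mn' cm]];
    first by lia.
  have gn : g <= n by lia.
  by have := elimT (saturatedP _ _ _ _) cm s g ltac:(lia) gn fs; lia.
rewrite (outer_next gs fs) //= (ltnW mn) andbT ltnS leq_eqVlt eq_sym.
by case: eqP => [->|] //; rewrite saturated_refl.
Qed.

(** A block below the face of [g] contributes its minimum, which is the preceding label of the face
    plus 1. The next sibling, or else the parent, carries the next element [s] of the block, which
    is the last label of the face plus 1. These are the values listed by [kids_outer]. *)
Lemma black_index_odd x k : dual_ok x -> x.1 = Black -> k < size (dual_step x)
  ->
  let y := nth x (dual_step x) k in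
  map snd (rcons [seq head z (dual_step z) | z <- dual_step y]
    (nth x (dual_step x) k.+1)) = kids n outer y.2.
Proof.
case: x => -[] q [/= qn _] //= _; rewrite /dual_step /= size_map => klt.
rewrite (nth_map 0) //=; set g := nth 0 _ k.
have [gs fs gap] := nth_block_below_next klt; set s := nth q _ _ in gs fs gap.
rewrite -/g in gs fs gap.
have -> : nth (Black, q) [seq (White, m) | m <- block_below q] k.+1 = 
   (if k.+1 < size (block_below q) then White else Black, s).
  case: ltnP => k1; last by rewrite /s !nth_default ?size_map.
  by rewrite (nth_map q).
rewrite map_rcons -!map_comp /= (@kids_outer g s) //; last by lia.
rewrite (_ : map _ (face_above g) = map block_min (face_above g)); last first.
  by apply: eq_map => m /=; rewrite /dual_step /= /block_min;
    case: (block_below m).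
have <- : (last g (face_above g)).+1 = s.
  by rewrite (@face_last _ _ _ f_nc g s) //; lia.
apply: (@eq_from_nth _ 0); first by rewrite size_rcons !size_map.
rewrite size_rcons size_map => i; rewrite ltnS leq_eqVlt => /orP[/eqP->|ilt].
  by rewrite nth_rcons size_map ltnn eqxx (nth_map 0) // (last_nth 0).
rewrite nth_rcons size_map ilt (nth_map 0) // (nth_map 0) ?block_min_face //.
by rewrite /= ltnS ltnW.
Qed.

Theorem janson_stefansson_black : 0 < n -> exists2 H, n <= H &
  janson_stefansson (grow dual_step n.+1 (Black, n)) = grow (kids n outer) H 0.
Proof.
(* As 0 is in the block of n, it labels the first child of the root, which becomes the root of the
   image. *)
move=> n_gt0; have bn : 0 < size (block_below n) /\ nth 0 (block_below n) 0 = 0.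
  have := mem_block_below f n 0; rewrite n_gt0 f0_last eqxx /=.
  have := @head_block_below _ n f n 0 (leq0n _) (leqnn _) f0_last.
  by case: (block_below n) => // x s /= ->.
have okn : dual_ok (Black, n) by split=> //= a.
apply: (janson_stefansson_grow (even := fun x => x.1 = Black) (idx := snd)
          dual_step_ok okn (dual_span_le okn) _ outer_nc) => //.
- by move=> m /andP[/(outerP n f)[]].
- exact: even_step.
- exact: black_index_odd.
- by case=> -[] q //= [_ maxq] _; exact: outer_max_kids.
- by rewrite /dual_step size_map; case: bn.
- by rewrite /dual_step /= (nth_map 0); case: bn.
Qed.

End BlackRoot.

End AbstractDual.

(** * Depth-first labels *)

Lemma prefix_rconsE (E : eqType) (u w : seq E) k :
  prefix u (rcons w k) = (u == rcons w k) || prefix u w.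
Proof.
apply/idP/orP => [/prefixP[s]|[/eqP->|/prefixP[s ->]]]; last first.
- by rewrite rcons_cat prefix_prefix.
- exact: prefix_refl.
elim/last_ind: s => [|s x _]; first by rewrite cats0 => ->; left.
by rewrite -rcons_cat => /rcons_inj[-> _]; right; exact: prefix_prefix.
Qed.

Lemma prefix_of_rcons (E : eqType) (w v : seq E) k : prefix (rcons w k) v ->
  prefix w v.
Proof. by move=> /prefixP[s ->]; rewrite cat_rcons prefix_prefix. Qed.

Lemma valid_prefix (V : eqType) (ch : V -> seq V) x u v :
  prefix u v -> valid ch x v -> valid ch x u.
Proof.
move=> /prefixP[s ->]; elim: u x => //= i u IH x /andP[-> /IH].
by [].
Qed.

Section LabelledTree.
Variables (n H : nat) (par : nat -> nat).
Hypothesis nH : n <= H.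
Hypothesis par_lt : forall m, 0 < m <= n -> par m < m.
Hypothesis par_nc : forall m1 m2, 0 < m1 -> m1 < m2 <= n -> par m2 < m1 ->
  par m2 <= par m1.

Local Notation kids := (kids n par).
Local Notation t := (grow kids H 0).

Definition vtx l := nth [::] (vertices t) l.

Lemma map_label_vertices : map (walk kids 0) (vertices t) = iota 0 n.+1.
Proof. by rewrite map_walk_vertices preorder_kids. Qed.

Lemma size_vertices : size (vertices t) = n.+1.
Proof. by rewrite -(size_map (walk kids 0)) map_label_vertices size_iota. Qed.

Lemma mem_vertices u : (u \in vertices t) = valid kids 0 u.
Proof. by apply: mem_vertices_grow; apply: fits_kids. Qed.

Lemma walk_vtx l : l <= n -> walk kids 0 (vtx l) = l.
Proof.
move=> ln; rewrite -(nth_map [::] 0) ?size_vertices // map_label_vertices.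
by rewrite nth_iota.
Qed.

Lemma vtx_valid l : l <= n -> valid kids 0 (vtx l).
Proof. by move=> ln; rewrite -mem_vertices mem_nth ?size_vertices. Qed.

Lemma vtx_walk u : valid kids 0 u -> walk kids 0 u <= n /\ vtx (walk kids 0 u)
  = u.
Proof.
rewrite -mem_vertices => /(nthP [::])[l]; rewrite size_vertices ltnS => ln <-.
by rewrite -/(vtx l) walk_vtx.
Qed.

Lemma vtx_inj l m : l <= n -> m <= n -> vtx l = vtx m -> l = m.
Proof. by move=> ln mn E; rewrite -(walk_vtx ln) E walk_vtx. Qed.

Lemma vtx_rcons m : 0 < m <= n ->
  exists2 k, vtx m = rcons (vtx (par m)) k &
    k < size (kids (par m)) /\ nth 0 (kids (par m)) k = m.
Proof.
case/andP=> m0 mn; have := walk_vtx mn; have := vtx_valid mn.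
elim/last_ind: (vtx m) => [_ /= E|u k _]; first by rewrite -E in m0.
rewrite valid_rcons walk_rcons => /andP[vu klt] E.
have wu : walk kids 0 u = par m.
  by have := mem_nth (walk kids 0 u) klt; rewrite E mem_kids => /andP[_ /eqP].
exists k; first by rewrite -wu (proj2 (vtx_walk vu)).
by rewrite -wu; split=> //; rewrite -[RHS]E; apply: set_nth_default.
Qed.

Lemma parent_vtx m : 0 < m <= n -> parent (vtx m) = vtx (par m).
Proof. by case/vtx_rcons => k -> _; rewrite parent_rcons. Qed.

Lemma same_parentE (i j : 'I_n) : same_parent t i j = (par i.+1 == par j.+1).
Proof.
rewrite /same_parent /nth_vertex -/(vtx _) -/(vtx _).
have [il jl] : 0 < i.+1 <= n /\ 0 < j.+1 <= n by split=> //=; exact: ltn_ord.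
rewrite !parent_vtx //; apply/eqP/eqP => [|-> //].
by apply: vtx_inj; have := par_lt il; have := par_lt jl; lia.
Qed.

Lemma is_last_child_vtx m : 0 < m <= n ->
  is_last_child t (vtx m) = (m == last 0 (kids (par m))).
Proof.
move=> mn; have [k E [klt km]] := vtx_rcons mn.
have pn : par m <= n by have := par_lt mn; lia.
rewrite /is_last_child parent_vtx // outdeg_grow ?fits_kids ?vtx_valid //
  walk_vtx // E.
rewrite eqseq_rcons eqxx /= -nth_last -{2}km nth_uniq //;
  first by case: size klt.
by apply/filter_uniq/iota_uniq.
Qed.

End LabelledTree.

(** * Recovering the blocks from siblings and twigs *)

Section Recovery.
Variables (T : eqType) (n H : nat) (f : nat -> T).
Hypothesis nH : n <= H.
Hypothesis f_nc : forall a b c d, a < b -> b < c -> c < d <= n ->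
  f a = f c -> f b = f d -> f a = f b.

Lemma same_parent_white (i j : 'I_n) : (forall a, 0 < a <= n -> f a <> f 0) ->
  same_parent (grow (kids n (white_parent f)) H 0) i j = (f i.+1 == f j.+1).
Proof.
move=> f0; rewrite same_parentE //.
- by rewrite (white_parent_eq f0) //=; exact: ltn_ord.
- exact: white_parent_lt f0.
- exact: white_parent_nc f_nc f0.
Qed.

Hypothesis f0_last : f 0 = f n.
Let par := outer n f.
Let par_lt m : 0 < m <= n -> par m < m.
Proof. by case/andP => /(outerP n f)[]. Qed.
Local Notation t := (grow (kids n par) H 0).
Local Notation vtx := (vtx n H par).

Lemma is_last_child_outer m : 0 < m <= n ->
  is_last_child t (vtx m) = (f m == f (par m)).
Proof.
move=> mn; have nc := @outer_nc _ n f; rewrite is_last_child_vtx //.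
have pm := par_lt mn; set p := par m in pm *.
have mk : m \in kids n par p by rewrite mem_kids mn eqxx.
(* Having the child [m], the vertex [p] cannot be the largest element of its block. *)
have [s ps fs] : exists2 s, p < s <= n & f s = f p.
  have [|s psn [fs maxs]] := @exists_max _ n f p; first by lia.
  exists s => //; suff : p <> s by lia.
  by move=> E; move: mk; rewrite outer_max_kids // E.
have [p_s sn] := andP ps; have [s' ps' [fs' gap]] := exists_next p_s fs.
have ps'n : p < s' <= n by lia.
have E := kids_outer ps'n fs'; rewrite E [last _ _]/= last_map.
rewrite (face_last f_nc ps'n fs' gap).
apply/eqP/eqP => [->|fm]; first by rewrite prednK //; lia.
have : ~ m < s' by move=> ms; apply: (gap m) => //; lia.
move: mk; rewrite -/par E => /mapP[m' m'in mE].
have := path_ltn_last (face_above_sorted n f p) m'in.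
rewrite (face_last f_nc ps'n fs' gap); lia.
Qed.

(** The parent of [j] is the preceding element [p] of its block, because the gap between them is a
    union of blocks. *)
Lemma outer_same_block i j : i < j <= n -> f i = f j -> i <= par j /\ f (par j)
  = f j.
Proof.
move=> ij fij; have ex : exists p, (p < j) && (f p == f j) by exists i;
  rewrite fij eqxx; lia.
have bnd p : (p < j) && (f p == f j) -> p <= j by case/andP => /ltnW.
have [p /andP[pj /eqP fp] maxp] := ex_maxnP ex bnd.
have pjn : p < j <= n by lia. have jn : 0 < j <= n by lia.
have ip : i <= p by apply: maxp; rewrite fij eqxx; lia.
suff -> : par j = p by [].
apply/eqP; rewrite (outer_next pjn (esym fp) jn) pj /=.
apply: saturated_gap => // a apj fa; suff : a <= p by lia.
by apply: maxp; rewrite fa fp eqxx; lia.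
Qed.

Let vtxP m : 0 < m <= n -> exists k, vtx m = rcons (vtx (par m)) k.
Proof.
by move=> mn; have [k E _] := vtx_rcons nH par_lt (@outer_nc _ n f) mn;
  exists k.
Qed.

(** Climbing from [j] runs down through the elements of its block until [i], each step starting from
    a last child. *)
Lemma is_twig_outer i j : i <= j <= n -> f i = f j -> is_twig t (vtx i) (vtx j).
Proof.
have [b] := ubnP j; elim: b j => // b IH j jb ij fij.
move: (ij); rewrite leq_eqVlt => /andP[/orP[/eqP->|i_j] jn].
  rewrite /is_twig prefix_refl; apply/allP => w _; apply/implyP.
  rewrite /on_path => /andP[/andP[ij' ji] /negP[]]; apply/eqP.
  have /prefixP[s E] := ij'; have /prefixP[s' E'] := ji.
  move: E'; rewrite E -catA => /(congr1 size); rewrite !size_cat => sz.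
  have -> : s = [::] by apply/nilP; rewrite /nilp; lia.
  by rewrite cats0.
have ijn : i < j <= n by lia. have j0 : 0 < j <= n by lia.
have [ip fp] := outer_same_block ijn fij; have pj := par_lt j0.
have /andP[pre all_last] : is_twig t (vtx i) (vtx (par j)).
  by apply: IH; rewrite ?fp //; lia.
have [k E] := vtxP j0.
rewrite /is_twig E prefix_rconsE pre orbT; apply/allP => w wt; apply/implyP.
rewrite /on_path prefix_rconsE => /andP[/andP[iw /orP[/eqP->|wp]] wi].
  by rewrite -E is_last_child_outer // fp.
by have /allP/(_ w wt)/implyP := all_last; apply; rewrite /on_path iw wp.
Qed.

Lemma twig_same_block u v w : valid (kids n par) 0 v -> is_twig t u v ->
  on_path u v w -> f (walk (kids n par) 0 w) = f (walk (kids n par) 0 u).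
Proof.
move=> vv /andP[uv /allP all_last].
elim/last_ind: w => [|w k IH] /andP[uw wv].
  by move: uw; case: u {uv all_last}.
move: uw; rewrite prefix_rconsE => /orP[/eqP-> //|uw].
have vw := valid_prefix wv vv.
have wv' := prefix_of_rcons wv; rewrite -IH ?/on_path ?uw //.
have [mn E] := vtx_walk nH par_lt (@outer_nc _ n f) vw.
set m := walk _ _ (rcons w k) in mn E *.
have m0 : 0 < m <= n.
  rewrite mn andbT lt0n; apply/negP => /eqP m0.
  have E0 := vtx_walk nH par_lt (@outer_nc _ n f) (u := [::]) isT.
  by have := proj2 E0; rewrite /= -m0 E; case: (w).
have := all_last (rcons w k); rewrite mem_vertices // vw => /(_ isT)/implyP.
rewrite /on_path prefix_rconsE uw orbT wv /= => last_w.
have [ku Ep] := vtxP m0.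
have vw' : valid (kids n par) 0 w by exact: valid_prefix wv' vv.
have wE : walk (kids n par) 0 w = par m.
  move: Ep; rewrite E => /rcons_inj[-> _];
    apply: (walk_vtx nH par_lt (@outer_nc _ n f)).
  by have := par_lt m0; lia.
have [uE|neq] := eqVneq (rcons w k) u.
  move: uw; rewrite -uE => /prefixP[s] /(congr1 size).
  by move/eqP; rewrite size_cat size_rcons addSn ltn_eqF // ltnS leq_addr.
by have := last_w neq; rewrite -E is_last_child_outer // wE => /eqP.
Qed.

Lemma same_twig_black (i j : 'I_n) : same_twig t i j = (f i.+1 == f j.+1).
Proof.
rewrite /same_twig /nth_vertex -/(vtx _) -/(vtx _).
have nc := @outer_nc _ n f.
apply/hasP/eqP => [[u ut /hasP[v vt /and3P[tw pi pj]]]|fij].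
  have vv : valid (kids n par) 0 v by rewrite -(mem_vertices nH par_lt).
  have := twig_same_block vv tw pi; have := twig_same_block vv tw pj.
  by rewrite !walk_vtx // => -> ->.
have vtx_mem l : l <= n -> vtx l \in vertices t by move=> ln;
  rewrite mem_vertices // vtx_valid.
have [ij|/ltnW ij] := leqP i j.
  have tw : is_twig t (vtx i.+1) (vtx j.+1) by apply: is_twig_outer;
    rewrite // ltnS ij ltn_ord.
  exists (vtx i.+1); first exact: vtx_mem.
  apply/hasP; exists (vtx j.+1); first exact: vtx_mem.
  by rewrite tw /on_path !prefix_refl; case/andP: tw => ->.
have tw : is_twig t (vtx j.+1) (vtx i.+1) by apply: is_twig_outer;
  rewrite // ltnS ij ltn_ord.
exists (vtx j.+1); first exact: vtx_mem.
apply/hasP; exists (vtx i.+1); first exact: vtx_mem.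
by rewrite tw /on_path !prefix_refl; case/andP: tw => ->.
Qed.

End Recovery.

(** * Polygons and white faces *)

Section Geometry.
Import Order.TTheory GRing.Theory Num.Theory numFieldNormedType.Exports.
Local Open Scope ring_scope.
Local Open Scope classical_set_scope.
Variables (R : realType) (n : nat).
Implicit Types (p q r : R * R) (x y z : R) (i j : 'I_n) (B : {set 'I_n}).

(** Twice the signed area of the triangle, negative when [p], [q], [r] turn clockwise. *)
Definition orient p q r : R :=
  (q.1 - p.1) * (r.2 - p.2) - (q.2 - p.2) * (r.1 - p.1).

Lemma orientC p q r : orient q p r = - orient p q r.
Proof. by rewrite /orient; ring. Qed.

Lemma orient_rot p q r : orient q r p = orient p q r.
Proof. by rewrite /orient; ring. Qed.

Lemma circle_ptE x : exists c s, [/\ c = cos (pi * x / n%:R), s = sin (pi * x /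
  n%:R),
  c ^+ 2 + s ^+ 2 = 1 & circle_pt n x = (c ^+ 2 - s ^+ 2, - (s * c *+ 2))].
Proof.
exists (cos (pi * x / n%:R)), (sin (pi * x / n%:R)); split=> //;
  first exact: cos2Dsin2.
have E : 2 * pi * x / n%:R = (pi * x / n%:R) *+ 2.
  by rewrite mulr2n; move: (n%:R^-1) => m; ring.
rewrite /circle_pt E cos_mulr2n sin_mulr2n; congr pair; last by rewrite mulrC.
by rewrite sin2cos2; ring.
Qed.

Lemma circle_pt_norm x : (circle_pt n x).1 ^+ 2 + (circle_pt n x).2 ^+ 2 = 1.
Proof. by rewrite /circle_pt /= sqrrN cos2Dsin2. Qed.

(* With 1 = c^2 + s^2 the points (1, cos, sin) become quadratic forms in
   half-angle sines and cosines, and the determinant is of Vandermonde type. *)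
Lemma orient_circle x y z :
  orient (circle_pt n x) (circle_pt n y) (circle_pt n z) =
  - (4 * sin (pi * y / n%:R - pi * x / n%:R) * sin (pi * z / n%:R - pi * y /
    n%:R) *
     sin (pi * z / n%:R - pi * x / n%:R)).
Proof.
rewrite !sinB.
have [a [b [<- <- uab ->]]] := circle_ptE x.
have [c [d [<- <- ucd ->]]] := circle_ptE y.
have [e [f [<- <- uef ->]]] := circle_ptE z.
have homog p q r : orient p q r = 1 * (q.1 * r.2 - q.2 * r.1)
    - 1 * (p.1 * r.2 - p.2 * r.1) + 1 * (p.1 * q.2 - p.2 * q.1).
  by rewrite /orient; ring.
by rewrite homog -{1}uab -{1}ucd -{1}uef /=; ring.
Qed.

(** Within one turn all three angles in [orient_circle] lie strictly between 0 and pi. *)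
Lemma orient_circle_lt0 x y z : x < y -> y < z -> z < x + n%:R ->
  orient (circle_pt n x) (circle_pt n y) (circle_pt n z) < 0.
Proof.
move=> xy yz zx; have n0 : 0 < n%:R :> R by lra.
have sin_gt0 (u v : R) : u < v -> v < u + n%:R -> 0 < sin (pi * v / n%:R - pi *
  u / n%:R).
  move=> uv vu; rewrite -mulrBl -mulrBr -mulrA; apply: sin_gt0_pi.
  have /andP[d0 d1] : 0 < (v - u) / n%:R < 1.
    apply/andP; split; first by apply: divr_gt0 => //; lra.
    by rewrite ltr_pdivrMr // mul1r; lra.
  by rewrite mulr_gt0 ?pi_gt0 //= gtr_pMr ?pi_gt0.
by rewrite orient_circle oppr_lt0 !mulr_gt0 // sin_gt0 //; lra.
Qed.

Lemma orient_hull p q B r (w : 'I_n -> R) :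
  \sum_(i in B) w i = 1 ->
  r.1 = \sum_(i in B) w i * (vertex_pt R i).1 ->
  r.2 = \sum_(i in B) w i * (vertex_pt R i).2 ->
  orient p q r = \sum_(i in B) w i * orient p q (vertex_pt R i).
Proof.
move=> w1 r1 r2.
(* The factors 1 are inserted in order to be replaced by the sum of the weights. *)
transitivity ((q.1 - p.1) * (r.2 - p.2 * 1) - (q.2 - p.2) * (r.1 - p.1 * 1)).
  by rewrite !mulr1.
rewrite -w1 r1 r2 !mulr_sumr -!sumrB !mulr_sumr -sumrB.
by apply: eq_bigr => i _; rewrite /orient; ring.
Qed.

Lemma hull_orient_gt0 p q B r : hull B r ->
  (forall i, i \in B -> 0 < orient p q (vertex_pt R i)) -> 0 < orient p q r.
Proof.
case=> w [w0 w1 r1 r2] pos; rewrite (orient_hull p q w1 r1 r2).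
have ge0 i : i \in B -> 0 <= w i * orient p q (vertex_pt R i).
  by move=> /pos/ltW; apply: mulr_ge0.
rewrite lt_def sumr_ge0 // andbT; apply/eqP => /eqP.
rewrite psumr_eq0 // => /allP E0.
have : \sum_(i in B) w i = 0.
  apply: big1 => i iB; have := E0 i (mem_index_enum _); rewrite iB /= mulf_eq0.
  by rewrite (gt_eqF (pos _ iB)) orbF => /eqP.
by rewrite w1 => /eqP; rewrite oner_eq0.
Qed.

Definition lerp t p q : R * R :=
  ((1 - t) * p.1 + t * q.1, (1 - t) * p.2 + t * q.2).

Lemma hull_segment B i j t : i \in B -> j \in B -> 0 <= t <= 1 ->
  hull B (lerp t (vertex_pt R i) (vertex_pt R j)).
Proof.
move=> iB jB t01.
have sumE (v : 'I_n -> R) : \sum_(k in B) ((1 - t) * (k == i)%:R + t * (k ==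
  j)%:R) * v k
    = (1 - t) * v i + t * v j.
  transitivity (\sum_(k in B) (1 - t) * ((k == i)%:R * v k) + \sum_(k in B) t *
    ((k == j)%:R * v k)).
    by rewrite -big_split /=; apply: eq_bigr => k _; ring.
  rewrite -!mulr_sumr; congr (_ * _ + _ * _).
    by rewrite (bigD1 i) //= eqxx mul1r big1 ?addr0 // => k /andP[_ /negbTE->];
      rewrite mul0r.
  by rewrite (bigD1 j) //= eqxx mul1r big1 ?addr0 // => k /andP[_ /negbTE->];
    rewrite mul0r.
exists (fun k => (1 - t) * (k == i)%:R + t * (k == j)%:R); split.
- by move=> k; rewrite addr_ge0 ?mulr_ge0 ?ler0n //; lra.
- have := sumE (fun=> 1); under eq_bigr do rewrite mulr1; move=> ->; lra.
- by rewrite sumE.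
- by rewrite sumE.
Qed.

Lemma vertex_lt i j : (i < j)%N -> i.+1%:R < j.+1%:R :> R.
Proof. by rewrite ltr_nat ltnS. Qed.

Lemma vertex_wrap i j : j.+1%:R < i.+1%:R + n%:R :> R.
Proof. by rewrite -natrD ltr_nat; have := ltn_ord j; lia. Qed.

(* The diagonals of a convex quadrilateral meet, at a point whose weights are
   the areas of the opposite triangles. *)
Lemma hulls_meet (A B : {set 'I_n}) (a b c d : 'I_n) : (a < b < c)%N -> (c <
  d)%N ->
  a \in A -> c \in A -> b \in B -> d \in B -> (hull A `&` hull B : set (R * R))
    !=set0.
Proof.
move=> /andP[ab bc] cd aA cA bB dB.
set pa := vertex_pt R a; set pb := vertex_pt R b; set pc := vertex_pt R c;
  set pd := vertex_pt R d.
have neg (i j k : 'I_n) : (i < j)%N -> (j < k)%N -> orient (vertex_pt R i)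
  (vertex_pt R j) (vertex_pt R k) < 0.
  by move=> ij jk; apply: orient_circle_lt0; rewrite ?vertex_lt ?vertex_wrap.
have o1 : orient pa pb pc < 0 by apply: neg.
have o2 : orient pb pc pd < 0 by apply: neg.
have o3 : orient pa pc pd < 0 by apply: neg => //; apply: ltn_trans bc.
have o4 : orient pa pb pd < 0 by apply: neg => //; apply: ltn_trans cd.
(* Both sides are twice the signed area of the quadrilateral, cut along either diagonal. *)
have S : orient pb pc pd + orient pa pb pd = orient pa pc pd + orient pa pb pc.
  by rewrite /orient; ring.
set s := orient pb pc pd + orient pa pb pd in S.
have s0 : s < 0 by rewrite /s; lra.
have s_neq0 : s != 0 by rewrite lt_eqF.
pose t := orient pa pb pd / s; pose u := orient pa pb pc / s.
have st : s * t = orient pa pb pd by rewrite /t mulrCA divff ?mulr1.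
have su : s * u = orient pa pb pc by rewrite /u mulrCA divff ?mulr1.
have lin (v y z : R) : s * ((1 - v) * y + v * z) = (s - s * v) * y + s * v * z
  by ring.
have frac (y : R) : y < 0 -> s <= y -> 0 <= y / s <= 1.
  by move=> y0 sy; rewrite ler_ndivrMr // mul1r sy andbT ler_ndivlMr // mul0r
    ltW.
exists (lerp t pa pc); split.
  by apply: hull_segment => //; apply: frac => //; rewrite /s; lra.
have -> : lerp t pa pc = lerp u pb pd.
  by rewrite /lerp; congr pair; apply: (mulfI s_neq0);
    rewrite !lin st su /s /orient; ring.
by apply: hull_segment => //; apply: frac => //; lra.
Qed.

Lemma noncrossing_blocks (P : {set {set 'I_n}}) A B (a b c d : 'I_n) :
  noncrossing R P ->
  A \in P -> B \in P -> (a < b < c)%N -> (c < d)%N ->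
  a \in A -> c \in A -> b \in B -> d \in B -> A = B.
Proof.
move=> nc AP BP abc cd aA cA bB dB; apply/eqP; apply/negPn/negP => AB.
by have [p] := hulls_meet abc cd aA cA bB dB; rewrite nc.
Qed.

End Geometry.

(** * Which arcs border the same white face *)

Section Geometry.
Import Order.TTheory GRing.Theory Num.Theory numFieldNormedType.Exports.
Local Open Scope ring_scope.
Local Open Scope classical_set_scope.
Variables (R : realType) (n : nat).
Implicit Types (p q r : R * R) (x y z t : R) (i j : 'I_n) (B : {set 'I_n}).

Local Notation cpt := (@circle_pt R n).

Lemma orient_circle_between x y z : x < z -> z < y -> y < x + n%:R ->
  0 < orient (cpt x) (cpt y) (cpt z).
Proof.
move=> xz zy yx; have := orient_circle_lt0 xz zy yx.
have -> : orient (cpt x) (cpt z) (cpt y) = - orient (cpt x) (cpt y) (cpt z).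
  by rewrite /orient; ring.
by rewrite oppr_lt0.
Qed.

Lemma orient_circle_before x y z : z < x -> x < y -> y < z + n%:R ->
  orient (cpt x) (cpt y) (cpt z) < 0.
Proof. by move=> zx xy yz; rewrite orient_rot; apply: orient_circle_lt0. Qed.

Lemma natS_le i j : (i < j)%N -> i.+1%:R + 1 <= j.+1%:R :> R.
Proof. by move=> ij; rewrite -(natrD _ _ 1) ler_nat; lia. Qed.

Lemma natS_wrap i j : j.+1%:R + 1 <= i.+1%:R + n%:R :> R.
Proof. by rewrite -(natrD _ _ 1) -natrD ler_nat; have := ltn_ord j; lia. Qed.

Lemma arc_mid_notin_hull B i : ~ hull B (arc_mid R i).
Proof.
(* The chord between the points at one and three quarters of the arc separates its midpoint from all
   vertices. *)
move=> Bi; pose p := cpt (i.+1%:R + 3 / 4 : R);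
  pose q := cpt (i.+1%:R + 1 / 4 : R).
have n1 := natS_wrap i i.
have : orient p q (arc_mid R i) < 0.
  by rewrite orientC oppr_lt0; apply: orient_circle_between; lra.
suff : 0 < orient p q (arc_mid R i) by lra.
apply: hull_orient_gt0 Bi _ => k _; rewrite orientC oppr_gt0.
have := natS_wrap i k; have := natS_wrap k i.
have [/natS_le ki|/natS_le ki|/val_inj->] := ltngtP k i => w1 w2.
- by apply: orient_circle_before; lra.
- by apply: orient_circle_lt0; lra.
- by apply: orient_circle_before; lra.
Qed.

Lemma orient_arcs_inside i j (a : 'I_n) : (i < a <= j)%N ->
  0 < orient (arc_mid R i) (arc_mid R j) (vertex_pt R a).
Proof.
move=> /andP[ia aj]; have := natS_wrap i j; have := natS_le ia.
have : a.+1%:R <= j.+1%:R :> R by rewrite ler_nat.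
by move=> w1 w2 w3; apply: orient_circle_between; lra.
Qed.

Lemma orient_arcs_outside i j (a : 'I_n) : (i < j)%N -> ~~ (i < a <= j)%N ->
  orient (arc_mid R i) (arc_mid R j) (vertex_pt R a) < 0.
Proof.
move=> ij; have w0 := natS_le ij; rewrite negb_and -leqNgt -ltnNge.
have w1 := natS_wrap i a; have w2 := natS_wrap a j.
move=> /orP[ai|/natS_le ja]; last by apply: orient_circle_lt0; lra.
have w3 : a.+1%:R <= i.+1%:R :> R by rewrite ler_nat.
by apply: orient_circle_before; lra.
Qed.

Lemma lerp_in_disk p q t : disk p -> disk q -> 0 <= t <= 1 -> disk (lerp t p q).
Proof.
case: p => a b; case: q => c d; rewrite /disk /lerp /= => ab cd t01.
have := sqr_ge0 (a - c); have := sqr_ge0 (b - d); move=> bd ac.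
have -> : ((1 - t) * a + t * c) ^+ 2 + ((1 - t) * b + t * d) ^+ 2 =
   (1 - t) * (a ^+ 2 + b ^+ 2) + t * (c ^+ 2 + d ^+ 2) -
   (1 - t) * t * ((a - c) ^+ 2 + (b - d) ^+ 2) by ring.
have /andP[t0 t1] := t01; have t1' : 0 <= 1 - t by lra.
have h1 : (1 - t) * (a ^+ 2 + b ^+ 2) <= (1 - t) * 1 by rewrite ler_wpM2l.
have h2 : t * (c ^+ 2 + d ^+ 2) <= t * 1 by rewrite ler_wpM2l.
have h3 : 0 <= (1 - t) * t * ((a - c) ^+ 2 + (b - d) ^+ 2).
  by rewrite !mulr_ge0 // addr_ge0.
lra.
Qed.

Lemma continuous_lerp p q : continuous (fun t => lerp t p q).
Proof.
have cont (a b : R) : continuous (fun t : R => (1 - t) * a + t * b).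
  move=> t; apply: cvgD; apply: cvgM; try exact: cvg_cst; last exact: cvg_id.
  by apply: cvgB; [exact: cvg_cst|exact: cvg_id].
move=> t; apply: (@cvg_pair _ _ _ _ (nbhs ((1 - t) * p.1 + t * q.1))
  (nbhs ((1 - t) * p.2 + t * q.2))); exact: cont.
Qed.

Lemma continuous_orient p q : continuous (orient p q).
Proof.
move=> r; apply: cvgB; apply: cvgM; try exact: cvg_cst; apply: cvgB;
  try exact: cvg_cst; [exact: (@cvg_snd _ _ (nbhs r.1))|exact: (@cvg_fst _ _ _
    (nbhs r.2))].
Qed.

Lemma orient_lerp p q t : orient p q (lerp t p q) = 0.
Proof. by rewrite /orient /lerp /=; ring. Qed.

(* In the disk, the line through two points of the circle is the chord. *)
Lemma orient_eq0_lerp x y r : orient (cpt x) (cpt y) r = 0 ->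
  cpt x != cpt y -> disk r ->
  exists2 t, 0 <= t <= 1 & r = lerp t (cpt x) (cpt y).
Proof.
have := circle_pt_norm n x; have := circle_pt_norm n y.
case: (cpt x) => a b; case: (cpt y) => c d; case: r => e f.
rewrite /orient /disk /lerp /= => cd ab o0 neq ef.
pose m := (c - a) ^+ 2 + (d - b) ^+ 2.
have m0 : 0 < m.
  rewrite lt_def addr_ge0 ?sqr_ge0 // andbT; apply: contra neq.
  rewrite paddr_eq0 ?sqr_ge0 // !sqrf_eq0 !subr_eq0 => /andP[/eqP-> /eqP->].
  exact: eqxx.
have mn0 : m != 0 by rewrite gt_eqF.
(* [t] is the parameter of the orthogonal projection of [r] on the line. *)
pose s := (e - a) * (c - a) + (f - b) * (d - b).
pose t := s / m; have tE (u v : R) : m * v = s * u -> t * u = v.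
  by move=> E; rewrite /t mulrAC -E mulrAC divff ?mul1r.
have E1 : t * (c - a) = e - a.
  apply: tE; apply/eqP; rewrite -subr_eq0; apply/eqP.
  transitivity (- (d - b) * ((c - a) * (f - b) - (d - b) * (e - a)));
    first by rewrite /m /s; ring.
  by rewrite o0 mulr0.
have E2 : t * (d - b) = f - b.
  apply: tE; apply/eqP; rewrite -subr_eq0; apply/eqP.
  transitivity ((c - a) * ((c - a) * (f - b) - (d - b) * (e - a)));
    first by rewrite /m /s; ring.
  by rewrite o0 mulr0.
have eE : e = (1 - t) * a + t * c by rewrite -[LHS](subrK a) -E1; ring.
have fE : f = (1 - t) * b + t * d by rewrite -[LHS](subrK b) -E2; ring.
exists t; last by rewrite -eE -fE.
(* As the endpoints are on the unit circle, this product is 1 minus the squared norm of [r]; its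
   sign forces [t] into [0, 1]. *)
have : 0 <= t * (1 - t) * m.
  have -> : t * (1 - t) * m = (1 - t) * (a ^+ 2 + b ^+ 2) + t * (c ^+ 2 + d ^+
    2) - (e ^+ 2 + f ^+ 2).
    by rewrite eE fE /m; ring.
  by rewrite ab cd; lra.
rewrite pmulr_lge0 // => t01; have [t0|t0] := leP 0 t;
  have [t1|t1] := leP t 1 => //.
- have : 0 < t * (t - 1) by rewrite mulr_gt0; lra.
  lra.
- have : 0 < (- t) * (1 - t) by rewrite mulr_gt0; lra.
  lra.
- lra.
Qed.

Variable P : {set {set 'I_n}}.

Let complement : set (R * R) := @disk R `\` \bigcup_(B in [set` P]) hull B.

Lemma complement_arc i : complement (arc_mid R i).
Proof.
split; first by rewrite /disk /= circle_pt_norm.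
by case=> B _; exact: arc_mid_notin_hull.
Qed.

Definition saturated_arcs i j :=
  forall B, B \in P -> forall a b : 'I_n, a \in B -> b \in B -> (i < a <= j)%N
    -> (i < b <= j)%N.

(* The chord between the two arcs avoids all polygons. *)
Lemma white_face_saturated i j : (i < j)%N -> saturated_arcs i j ->
  white_face P i = white_face P j :> set (R * R).
Proof.
move=> ij sat; apply: same_connected_component.
pose seg t := lerp t (arc_mid R i) (arc_mid R j).
have seg_conn : connected (seg @` `[0, 1]).
  apply: connected_continuous_connected; first exact: segment_connected.
  by apply: continuous_subspaceT; exact: continuous_lerp.
apply: (connected_component_max (B := seg @` `[0, 1])) => //.
- exists 0; first by rewrite /= in_itv /= lexx ler01.
  by rewrite /seg /lerp subr0 !mul1r !mul0r !addr0 -surjective_pairing.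
- move=> p [t /= t01 <-]; rewrite in_itv /= in t01; split.
    by apply: lerp_in_disk => //; rewrite /disk /= circle_pt_norm.
  move=> [B /= BP Bt]; have o0 := orient_lerp (arc_mid R i) (arc_mid R j) t.
  (* All vertices of [B] lie strictly on one side of the chord, so [orient] cannot vanish on its
     hull. *)
  have [[a aB aij]|none] := pselect (exists2 a : 'I_n, a \in B & (i < a <=
    j)%N).
    have : 0 < orient (arc_mid R i) (arc_mid R j) (seg t).
      apply: hull_orient_gt0 Bt _ => b bB; apply: orient_arcs_inside.
      exact: sat BP a b aB bB aij.
    by rewrite o0 ltxx.
  have : 0 < orient (arc_mid R j) (arc_mid R i) (seg t).
    apply: hull_orient_gt0 Bt _ => b bB; rewrite orientC oppr_gt0.
    apply: orient_arcs_outside => //; apply/negP => bij; apply: none;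
      by exists b.
  by rewrite orientC o0 oppr0 ltxx.
- exists 1; first by rewrite /= in_itv /= lexx ler01.
  by rewrite /seg /lerp subrr !mul1r !mul0r !add0r -surjective_pairing.
Qed.

(* A block with vertices on both sides contains a chord separating the arcs. *)
Lemma saturated_white_face i j : (i < j)%N ->
  white_face P i = white_face P j :> set (R * R) -> saturated_arcs i j.
Proof.
move=> ij faceE B BP a b aB bB aij; apply/negPn/negP => bij.
pose C : set (R * R) := white_face P i;
  pose g := orient (vertex_pt R a) (vertex_pt R b).
have Ci : C (arc_mid R i) by apply: connected_component_refl;
  exact: complement_arc.
have Cj : C (arc_mid R j).
  by rewrite /C faceE; apply: connected_component_refl; exact: complement_arc.
(* The function [g] has opposite signs at the two arcs, so it would vanish somewhere on the
   connected face; but in the disk its zeros are on the chord, inside the hull of [B]. *)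
have gC : is_interval (g @` C).
  apply/connected_intervalP/connected_continuous_connected;
    first exact: component_connected.
  by apply: continuous_subspaceT; exact: continuous_orient.
have ab : vertex_pt R a != vertex_pt R b.
  apply: contraNneq bij => E; have := orient_arcs_inside aij; rewrite E => ob.
  apply/negPn/negP => /(orient_arcs_outside ij); lra.
have no_zero : ~ (g @` C) 0.
  move=> [r Cr gr0]; have [rD rB] := connected_component_sub Cr.
  have [t t01 rE] := orient_eq0_lerp gr0 ab rD.
  by apply: rB; exists B => //; rewrite rE; exact: hull_segment.
have /andP[ia aj] := aij.
have w1 := natS_le ia; have w2 : a.+1%:R <= j.+1%:R :> R by rewrite ler_nat.
have w3 := natS_wrap i j; have w4 := natS_wrap b a; have w5 := natS_wrap a b.
have w6 := natS_wrap b j; have w7 := natS_wrap i b.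
have /andP[gi gj] : g (arc_mid R i) < 0 < g (arc_mid R j).
  move: bij; rewrite negb_and -leqNgt -ltnNge => /orP[bi|/natS_le jb];
    last first.
    apply/andP; split; first by apply: orient_circle_before; lra.
    by apply: orient_circle_between; lra.
  have w8 : b.+1%:R <= i.+1%:R :> R by rewrite ler_nat.
  apply/andP; split; rewrite /g orientC.
    by rewrite oppr_lt0; apply: orient_circle_between; lra.
  by rewrite oppr_gt0; apply: orient_circle_lt0; lra.
apply/no_zero/(gC (g (arc_mid R i)) (g (arc_mid R j)));
  [by exists (arc_mid R i)|by exists (arc_mid R j)|].
by rewrite !ltW.
Qed.

End Geometry.

(** * Labels of the dual tree *)

Section Labels.
Variable n : nat.
Implicit Types (S : {set 'I_n}) (p : pred 'I_n) (i k : 'I_n).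

Definition label (i : 'I_n) : nat := i.+1.

Lemma labels_sorted S p : sorted ltn (map label [seq k : 'I_n <- enum S | p k]).
Proof.
rewrite sorted_map; apply: sorted_filter => [x y z|]; first exact: ltn_trans.
rewrite /enum_mem; apply: sorted_filter => [x y z|]; first exact: ltn_trans.
by have := iota_ltn_sorted 0 n; rewrite -val_enum_ord sorted_map enumT.
Qed.

Lemma eq_labels (s : seq nat) S p : sorted ltn s ->
  (forall l, l \in s -> 0 < l <= n) ->
  (forall k : 'I_n, (k.+1 \in s) = (k \in S) && p k) ->
  s = map label [seq k : 'I_n <- enum S | p k].
Proof.
move=> srt sn sE; apply: (irr_sorted_eq ltn_trans ltnn) srt (labels_sorted _ _)
  _ => l.
apply/idP/mapP => [ls|[k]]; last first.
  by rewrite mem_filter mem_enum andbC -sE => ks ->.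
have := sn l ls; case: l ls => // l ls ln; exists (Ordinal ln) => //.
by rewrite mem_filter mem_enum andbC -sE.
Qed.

Lemma enum_split S i : i \in S ->
  enum S = [seq k : 'I_n <- enum S | k < i] ++ i :: [seq k : 'I_n <- enum S | i
    < k].
Proof.
move=> iS; have := labels_sorted S predT; rewrite filter_predT sorted_map.
have : i \in enum S by rewrite mem_enum.
case/splitPr => s1 s2; have tr : transitive (relpre label ltn) by move=> x y z;
  exact: ltn_trans.
rewrite (sorted_pairwise tr) pairwise_cat /= => /and4P[].
rewrite allrel_consr => /andP[/allP lt1 _] _ /allP gt2 _.
rewrite !filter_cat /= ltnn.
have -> : [seq k : 'I_n <- s1 | i < k] = [::].
  by rewrite (eq_in_filter (a2 := pred0)) ?filter_pred0 // => k /lt1 ki;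
    apply/negbTE; rewrite -leqNgt; exact: ltnW.
have -> : [seq k : 'I_n <- s2 | k < i] = [::].
  by rewrite (eq_in_filter (a2 := pred0)) ?filter_pred0 // => k /gt2 ki;
    apply/negbTE; rewrite -leqNgt; exact: ltnW.
have -> : [seq k : 'I_n <- s1 | k < i] = s1 by apply/all_filterP/allP => k /lt1.
have -> : [seq k : 'I_n <- s2 | i < k] = s2 by apply/all_filterP/allP => k /gt2.
by rewrite cats0.
Qed.

Lemma rot_index_enum S i : i \in S ->
  rot (index i (enum S)) (enum S) =
  i :: [seq k : 'I_n <- enum S | i < k] ++ [seq k : 'I_n <- enum S | k < i].
Proof.
move/enum_split; set s1 := [seq k <- _ | _]; set s2 := [seq k <- _ | _] => ->.
by rewrite index_cat mem_filter ltnn /= eqxx addn0 rot_size_cat.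
Qed.

Variable hn : 0 < n.

Lemma last_label_max i : i <= last_label hn.
Proof. by rewrite -ltnS /= prednK. Qed.

Lemma upper_last S : [seq k : 'I_n <- enum S | last_label hn < k] = [::].
Proof.
by rewrite (eq_in_filter (a2 := pred0)) ?filter_pred0 // => k _;
  rewrite ltnNge last_label_max.
Qed.

End Labels.

(** * The dual tree as a tree of labels *)

Section DualLink.
Variables (R : realType) (n : nat) (hn : 0 < n) (P : {set {set 'I_n}}).
Hypothesis hP : finset.partition P [set: 'I_n].
Hypothesis hnc : noncrossing R P.
Variable rooted_black : bool.
Implicit Types (i j k : 'I_n).

Local Notation last := (last_label hn).
Local Notation block := (finset.pblock P).

(* The arc from n to 1 gets the extra label 0, which is a block of its own when
   the tree is rooted at a white face and joins the block of n otherwise. *)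
Definition block_of (l : nat) : {set 'I_n} :=
  if l is l'.+1 then oapp block finset.set0 (insub l')
  else if rooted_black then block last else finset.set0.

Local Notation f := block_of.

Lemma block_of_label i : f i.+1 = block i.
Proof. by rewrite /= valK. Qed.

Lemma mem_block i : i \in block i.
Proof. by rewrite finset.mem_pblock (finset.cover_partition hP) finset.inE. Qed.

Lemma block_in i : block i \in P.
Proof. by rewrite finset.pblock_mem // (finset.cover_partition hP) finset.inE.
  Qed.

Lemma eq_block i j : (block i == block j) = (j \in block i).
Proof.
by rewrite finset.eq_pblock ?(finset.partition_trivIset hP) //
  (finset.cover_partition hP) finset.inE.
Qed.

Lemma block_neq0 i : block i <> finset.set0.
Proof. by move=> E; have := mem_block i; rewrite E finset.inE. Qed.

Lemma label_ord l : 0 < l <= n -> exists i, l = i.+1.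
Proof. by case: l => // l ln; exists (Ordinal ln). Qed.

Lemma block_of_nc_pos a b c d : 0 < a -> a < b -> b < c -> c < d <= n ->
  f a = f c -> f b = f d -> f a = f b.
Proof.
move=> a0 ab bc cd.
have [i ai] : exists i, a = i.+1 by apply: label_ord; lia.
have [j bj] : exists i, b = i.+1 by apply: label_ord; lia.
have [k ck] : exists i, c = i.+1 by apply: label_ord; lia.
have [l dl] : exists i, d = i.+1 by apply: label_ord; lia.
rewrite ai bj ck dl !block_of_label => /eqP; rewrite eq_block => ik /eqP;
  rewrite eq_block => jl.
apply: (noncrossing_blocks (a := i) (b := j) (c := k) (d := l) hnc);
  rewrite ?block_in ?mem_block //; lia.
Qed.

Lemma block_of_last : f n = block last.
Proof. by rewrite -block_of_label; congr block_of; rewrite /= prednK. Qed.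

(** Only [a] can be 0. For the white root no other label is in its block; for the black root 0 is
    replaced by n, which comes after [d] cyclically. *)
Lemma block_of_nc a b c d : a < b -> b < c -> c < d <= n ->
  f a = f c -> f b = f d -> f a = f b.
Proof.
move=> ab bc cd; have [a0|] := posnP a; last by move=> a0;
  exact: block_of_nc_pos.
have [k ck] : exists i, c = i.+1 by apply: label_ord; lia.
rewrite a0 [f 0]/= ck; case: ifP => _; last first.
  by rewrite block_of_label => E; case: (block_neq0 (esym E)).
rewrite -block_of_last -ck => fnc fbd.
have [dn|dn] := eqVneq d n; first by rewrite fbd dn.
by rewrite fnc; apply/esym; apply: (@block_of_nc_pos b c d n) => //; lia.
Qed.

(** The side condition excludes intervals ending at n for the black root: 0 is then in the block of
    n but outside the interval. *)
Lemma saturated_arcsP i j : (i < j)%N -> (rooted_black -> j <> last) ->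
  saturated n f i.+1 j.+1 <-> saturated_arcs P i j.
Proof.
move=> ij jlast; split=> [/saturatedP sat B BP a b aB bB aij|sat].
  have fab : f a.+1 = f b.+1.
    rewrite !block_of_label; have tP := finset.partition_trivIset hP.
    by rewrite !(finset.def_pblock tP BP).
  by have := sat a.+1 b.+1 aij (ltn_ord b) fab.
apply/saturatedP => a b aij bn fab; have jn := ltn_ord j.
have [k ak] : exists k, a = k.+1 by apply: label_ord; lia.
have kij : i < k <= j by lia.
have [b0|b0] := posnP b; last first.
  have [l bl] : exists i, b = i.+1 by apply: label_ord; lia.
  rewrite bl; apply: (sat (block k) (block_in k) k) => //;
    first exact: mem_block.
  by move: fab; rewrite ak bl !block_of_label => /eqP; rewrite eq_block.
move: fab; rewrite b0 [f 0]/= ak block_of_label; case: ifP => [rb|_ E];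
  last by case: (block_neq0 E).
move=> /eqP; rewrite eq_block => lastk.
have := sat _ (block_in k) k last (mem_block k) lastk kij.
have := jlast rb; move=> jl /andP[_ lj]; case: jl; apply: val_inj => /=.
by move: lj => /=; lia.
Qed.

(** Complementation: {1, ..., j+1} is a union of blocks exactly when {j+2, ..., n} is. *)
Lemma saturated0_arcsP j : (j < last)%N ->
  saturated n f 0 j.+1 <-> saturated_arcs P j last.
Proof.
move=> jl; have ln : last.+1 = n by rewrite /= prednK.
split=> [/saturatedP sat B BP a b aB bB ajl|sat].
  have bn := ltn_ord b; have [|bj] := ltnP j b; first by rewrite last_label_max.
  have fab : f b.+1 = f a.+1.
    rewrite !block_of_label; have tP := finset.partition_trivIset hP.
    by rewrite !(finset.def_pblock tP BP).
  by have := sat b.+1 a.+1 bj (ltn_ord a) fab; lia.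
apply/saturatedP => a b aj bn fab; have jn := ltn_ord j.
have [k ak] : exists k, a = k.+1 by apply: label_ord; lia.
have out (l : 'I_n) : l \in block k -> ~~ (j < l <= last).
  move=> lk; apply/negP => ljl; have := sat _ (block_in k) l k lk (mem_block k)
    ljl; lia.
have [b0|b0] := posnP b; last first.
  have [l bl] : exists i, b = i.+1 by apply: label_ord; lia.
  have lk : l \in block k by move: fab; rewrite ak bl !block_of_label => /eqP;
    rewrite eq_block.
  by have := out l lk; have := ltn_ord l; lia.
move: fab; rewrite b0 [f 0]/= ak block_of_label; case: ifP => [rb|_ E];
  last by case: (block_neq0 E).
by move=> /eqP; rewrite eq_block => /out; lia.
Qed.

Lemma star_refl c i : i \in star R P c i.
Proof. by case: c => /=; [rewrite finset.inE;
  apply/asboolP|exact: mem_block]. Qed.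

Lemma mem_white_star i j : i < j ->
  (j \in star R P White i) = `[< saturated_arcs P i j >].
Proof.
move=> ij; rewrite finset.inE; apply/asboolP/asboolP => [E|sat].
  exact: (saturated_white_face ij (esym E)).
exact/esym/white_face_saturated.
Qed.

Lemma mem_white_star_gt i j : j < i ->
  (j \in star R P White i) = `[< saturated_arcs P j i >].
Proof.
move=> ji; rewrite finset.inE; apply/asboolP/asboolP => [E|sat].
  exact: (saturated_white_face ji E).
exact: white_face_saturated.
Qed.

(** The arc from n to 1 counts as 0 when it leads to a white vertex, so that it is the smallest
    label of its face. *)
Definition node_label (x : colour * 'I_n) : colour * nat :=
  (x.1, match x.1 with
        | Black => x.2.+1
        | White => if x.2 == last then 0 else x.2.+1
        end).

Definition node_ok (x : colour * 'I_n) : Prop :=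
  match x.1 with
  | Black => (forall k, k \in block x.2 -> k <= x.2) /\ (rooted_black -> x.2 <>
    last)
  | White => (rooted_black /\ x.2 = last) \/ exists2 k : 'I_n, x.2 < k & k \in
    block x.2
  end.

Lemma dual_childrenE c i : dual_children R P (c, i) =
  [seq (opp_colour c, j) | j <- [seq k : 'I_n <- enum (star R P c i) | i < k] ++
                                [seq k : 'I_n <- enum (star R P c i) | k < i]].
Proof. by rewrite /dual_children /clockwise rot_index_enum //= star_refl. Qed.

Lemma block_below_labels i : (forall k, k \in block i -> k <= i) ->
  (rooted_black -> i <> last) ->
  block_below f i.+1 = map (@label n) [seq k : 'I_n <- enum (block i) | k < i].
Proof.
move=> maxi ilast; apply: eq_labels.
- by rewrite (sorted_filter ltn_trans) ?iota_ltn_sorted.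
- move=> l; rewrite mem_block_below => /andP[li]; have := ltn_ord i.
  case: l li => [|l] li; last by lia.
  rewrite block_of_label [f 0]/= => _;
    case: ifP => [rb|_ /eqP/esym/block_neq0 //].
  rewrite eq_sym eq_block => /maxi; have := last_label_max hn i => h1 h2.
  by case: (ilast rb); apply/val_inj/anti_leq; rewrite h1 h2.
- by move=> k; rewrite mem_block_below !block_of_label eq_sym eq_block ltnS
  andbC.
Qed.

Lemma face_above_labels i : node_ok (White, i) -> i <> last ->
  face_above n f i.+1 = map (@label n) [seq k : 'I_n <- enum (star R P White i)
    | i < k].
Proof.
move=> [[_ //]|[k ik kb]] ilast; apply: eq_labels.
- by rewrite (sorted_filter ltn_trans) ?iota_ltn_sorted.
- by move=> l; rewrite mem_face_above; lia.
move=> j; rewrite mem_face_above ltnS ltn_ord andbT andbC.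
have [ij|] := ltnP i j; rewrite ?andbF // !andbT mem_white_star //.
have [jl|jl] := eqVneq j last; last first.
  by apply/idP/asboolP => /(saturated_arcsP ij (fun _ => elimN eqP jl)).
(* The later element [k] of the block of [i] keeps the arc from n to 1 out of the face. *)
have ni : ~ saturated_arcs P i j.
  move=> sat; have := sat _ (block_in i) k i kb (mem_block i).
  by rewrite ik jl last_label_max ltnn => /(_ isT).
apply/idP/asboolP => // /saturatedP sat; exfalso; apply: ni.
move=> B BP a b aB bB aij.
have fab : f a.+1 = f b.+1.
  rewrite !block_of_label; have tP := finset.partition_trivIset hP.
  by rewrite !(finset.def_pblock tP BP).
by have := sat a.+1 b.+1 aij (ltn_ord b) fab.
Qed.

(** For the white root, the edge n is also an edge to a child and keeps the label n; for the black
    root it leads to the parent and is left out. *)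
Lemma face_above0_labels :
  face_above n f 0 = map (@label n)
    [seq k : 'I_n <- enum (star R P White last) | rooted_black ==> (k < last)].
Proof.
apply: eq_labels.
- by rewrite (sorted_filter ltn_trans) ?iota_ltn_sorted.
- by move=> l; rewrite mem_face_above; lia.
move=> j; rewrite mem_face_above ltn0Sn ltn_ord !andTb.
have [jl|jl] := ltnP j last.
  rewrite implybT andbT mem_white_star_gt //.
  by apply/idP/asboolP => /(saturated0_arcsP jl).
have {jl} -> : j = last by apply: val_inj; apply/eqP;
  rewrite eqn_leq last_label_max jl.
rewrite star_refl implybF andTb (_ : last.+1 = n); last by rewrite /= prednK.
have sat0 : saturated n f 0 n <-> ~ rooted_black.
  split=> [/saturatedP sat rb|rb].
    have f0n : f n = f 0 by rewrite block_of_last /= rb.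
    by have := sat n 0; rewrite hn leqnn => /(_ isT isT f0n).
  apply/saturatedP => a b an bn fab; rewrite bn andbT lt0n;
    apply/negP => /eqP b0.
  have [k ak] := label_ord an; move: fab; rewrite ak b0 block_of_label [f 0]/=.
  by case: ifP => // _; exact: block_neq0.
by apply/idP/negP => /sat0.
Qed.

Lemma lower_white_star i : node_ok (White, i) -> i <> last ->
  [seq k : 'I_n <- enum (star R P White i) | k < i] = [::].
Proof.
move=> [[_ //]|[k ik kb]] _; apply/eqP;
  rewrite -[_ == _]negbK -has_filter -all_predC.
apply/allP => j; rewrite mem_enum /= => ji; apply/negP => jlti.
move: ji; rewrite mem_white_star_gt // => /asboolP sat.
have := sat _ (block_in i) i k (mem_block i) kb.
by rewrite jlti leqnn => /(_ isT)/andP[_]; rewrite leqNgt ik.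
Qed.

Lemma dual_children_label x : node_ok x ->
  dual_step n f (node_label x) = map node_label (dual_children R P x).
Proof.
case: x => -[] i oki; rewrite dual_childrenE /dual_step /node_label /=;
  last first.
  have [maxi ilast] := oki; rewrite block_below_labels //.
  have -> : [seq k : 'I_n <- enum (block i) | i < k] = [::].
    apply/eqP; rewrite -[_ == _]negbK -has_filter -all_predC.
    by apply/allP => j; rewrite mem_enum /= -leqNgt => /maxi.
  rewrite cat0s -!map_comp; apply/eq_in_map => k;
    rewrite mem_filter => /andP[ki _] /=.
  by rewrite ifN //; apply: contraTneq ki => ->; rewrite -leqNgt last_label_max.
have [il|/eqP il] := eqVneq i last.
  have rb : rooted_black by case: oki => [[]|[k]] //;
    rewrite il ltnNge last_label_max.
  rewrite il upper_last face_above0_labels rb -!map_comp /=.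
  by apply: eq_map.
by rewrite face_above_labels // lower_white_star // cats0 -!map_comp;
  apply: eq_map.
Qed.

Lemma white_star_last_max j k : j \in star R P White last -> k \in block j -> k
  <= j.
Proof.
move=> jl kj; have [jlt|lj] := ltnP j last; last by apply: leq_trans lj;
  exact: last_label_max.
move: jl; rewrite mem_white_star_gt // => /asboolP sat; rewrite leqNgt;
  apply/negP => jk.
by have := sat _ (block_in j) k j kj (mem_block j);
  rewrite jk last_label_max ltnn => /(_ isT).
Qed.

Lemma block_below_last : rooted_black ->
  block_below f n = 0 :: map (@label n) [seq k : 'I_n <- enum (block last) | k
    < last].
Proof.
move=> rb; have ioE : iota 0 n = 0 :: iota 1 n.-1 by case: (n) hn.
rewrite /block_below ioE [LHS]/= rb block_of_last eqxx; congr cons;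
  apply: eq_labels.
- by rewrite (sorted_filter ltn_trans) ?iota_ltn_sorted.
- by move=> l; rewrite mem_filter mem_iota => /andP[_]; lia.
move=> k; rewrite mem_filter mem_iota block_of_label eq_sym eq_block.
by congr andb; rewrite /= add1n ltnS.
Qed.

Lemma dual_children_ok x y : node_ok x -> y \in dual_children R P x -> node_ok
  y.
Proof.
case: x => -[] i oki; rewrite dual_childrenE => /mapP[j jin ->] {y} /=;
  last first.
  have [maxi _] := oki; right; exists i; last first.
    rewrite -eq_block eq_sym eq_block; move: jin.
    by rewrite mem_cat => /orP[]; rewrite mem_filter mem_enum => /andP[].
  move: jin; rewrite mem_cat => /orP[];
    rewrite mem_filter mem_enum => /andP[] // ij /maxi.
  by rewrite leqNgt /= ij.
have [il|/eqP il] := eqVneq i last.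
  move: jin; rewrite il upper_last cat0s mem_filter mem_enum => /andP[jl];
    move=> jw.
  split; last by move=> _ /= E; move: jl; rewrite E ltnn.
  by move=> k; apply: white_star_last_max.
move: jin; rewrite lower_white_star // cats0 mem_filter mem_enum => /andP[ij].
rewrite mem_white_star // => /asboolP sat; split=> /=.
  move=> k kj; by have := sat _ (block_in j) j k (mem_block j) kj;
    rewrite ij leqnn => /(_ isT)/andP[].
move=> _ jl; case: oki => [[_ //]|[k /= ik kb]].
have := sat _ (block_in i) k i kb (mem_block i).
by rewrite ik jl last_label_max ltnn => /(_ isT).
Qed.

Lemma dual_branch_step c i : node_ok (c, i) ->
  dual_branch R P c i = grow (dual_step n f) n (node_label (c, i)).
Proof.
by move=> oki; apply: grow_simulation oki;
  [exact: dual_children_label|exact: dual_children_ok].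
Qed.

End DualLink.

(** * The two rooted dual trees and the conclusion *)

Section Trees.
Variables (R : realType) (n : nat) (hn : 0 < n) (P : {set {set 'I_n}}).
Hypothesis hP : finset.partition P [set: 'I_n].

Lemma dual_white_step :
  dual_white R P hn = grow (dual_step n (block_of hn P false)) n.+1 (White, 0).
Proof.
rewrite /dual_white /clockwise rot_index_enum ?(star_refl R hP) // upper_last
  cat0s.
rewrite [RHS]/= /dual_step [(White, 0).1]/= [(White, 0).2]/=.
(* [rot 1] moves the edge n to the end, which restores the increasing order. *)
rewrite (face_above0_labels R hn hP false) filter_predT rot1_cons.
have := enum_split (star_refl R hP White (last_label hn));
  rewrite upper_last => /esym E.
rewrite -cats1 E -!map_comp; congr PNode; apply/eq_in_map => j /=.
rewrite mem_enum => jin; rewrite (@dual_branch_step R n hn P hP false) //.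
by split=> // k; apply: (white_star_last_max hP jin).
Qed.

Lemma dual_black_step :
  dual_black R P hn = grow (dual_step n (block_of hn P true)) n.+1 (Black, n).
Proof.
rewrite /dual_black /clockwise rot_index_enum ?(star_refl R hP) // upper_last
  cat0s.
rewrite [RHS]/= /dual_step [(Black, n).1]/= [(Black, n).2]/=.
rewrite (block_below_last hn hP) // -map_comp; congr PNode.
have step j : j \in finset.pblock P (last_label hn) -> dual_branch R P White j =
    grow (dual_step n (block_of hn P true)) n (node_label hn (White, j)).
  move=> jb; rewrite (@dual_branch_step R n hn P hP true) //.
  have [->|jl] := eqVneq j (last_label hn); [by left|right;
    exists (last_label hn)].
    by rewrite ltn_neqAle last_label_max andbT.
  by rewrite -(eq_block hP) eq_sym (eq_block hP).
(* The first child is reached by the edge n, whose label becomes 0. *)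
rewrite map_cons [RHS]map_cons -map_comp step ?(mem_block hP) // /node_label /=
  eqxx.
congr cons; apply/eq_in_map => j;
  rewrite mem_filter mem_enum => /andP[jl jb] /=.
by rewrite step // /node_label /= ifN //; apply: contraTneq jl => ->;
  rewrite ltnn.
Qed.

Lemma partition_of_rel (r : rel 'I_n) :
  (forall i j, r i j = (finset.pblock P i == finset.pblock P j)) ->
  P = equivalence_partition r [set: 'I_n].
Proof.
move=> rE; rewrite -{1}(equivalence_partition_pblock hP).
apply: finset.eq_imset => i; apply/finset.setP => j.
by rewrite !finset.inE rE (eq_block hP).
Qed.

End Trees.

Theorem proposition4 (R : realType) (n : nat) (hn : (0 < n)%N)
    (P : {set {set 'I_n}})
    (hP : finset.partition P [set: 'I_n])
    (hnc : noncrossing R P) :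
  P = partition_white n (janson_stefansson (dual_white R P hn)) /\
  P = partition_black n (janson_stefansson (dual_black R P hn)).
Proof.
split; apply: (partition_of_rel hP) => i j.
  have nc := @block_of_nc R n hn P hP hnc false.
  have single a : 0 < a <= n -> block_of hn P false a <> block_of hn P false 0.
    by move=> /label_ord[k ->]; rewrite block_of_label; exact: (block_neq0 hP).
  rewrite (dual_white_step R hn hP).
  have [H nH ->] := janson_stefansson_white nc single hn.
  by rewrite (same_parent_white nH nc) // !block_of_label.
have nc := @block_of_nc R n hn P hP hnc true.
have f0 : block_of hn P true 0 = block_of hn P true n by rewrite block_of_last.
rewrite (dual_black_step R hn hP).
have [H nH ->] := janson_stefansson_black nc f0 hn.
by rewrite (same_twig_black nH nc f0) !block_of_label.
Qed.
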